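(* Let $\mathit{bf}=\forall x\,\Box P(x)\to\Box\forall x\,P(x)$ be the Barcan formula, and let $L$ be any predicate modal logic such that $\mathbf{QK4.3}\subseteq L\subseteq \mathbf{QK4.3.D.X}\oplus\mathit{bf}$ or $\mathbf{QS4.3}\subseteq L\subseteq\mathbf{QS4.3}\oplus\mathit{bf}$. Fix two distinct individual variables $x,y$, one monadic (unary) predicate letter $P$ and one proposition letter (nullary predicate letter) $p$. Then the set of all formulas $\varphi\in L$ such that every individual variable occurring in $\varphi$ (free or bound) is among $x,y$ and every predicate letter occurring in $\varphi$ is among $P,p$ is $\Sigma^0_1$-hard.
   Context: Predicate modal formulas are obtained by enriching the classical first-order predicate language (countably many individual variables, countably many predicate letters of each arity $n\ge 0$, no equality, no function symbols or individual constants; Boolean connectives, including $\top$, and quantifiers $\forall,\exists$) with a unary modal connective $\Box$; $\Diamond\varphi$ abbreviates $\neg\Box\neg\varphi$. Nullary predicate letters are called proposition letters; unary predicate letters are called monadic. $\mathbf{QCl}$ is the classical first-order predicate logic (the set of its valid formulas). For a set of formulas $\Gamma$ and a formula $\varphi$, $\Gamma\oplus\varphi$ denotes the closure of $\Gamma\cup\{\varphi\}$ under modus ponens, generalization (from $\psi$ infer $\forall x\,\psi$), necessitation (from $\psi$ infer $\Box\psi$), and predicate substitution (uniform substitution of modal formulas for predicate letters, with the usual provisos avoiding capture of variables). With $p,q$ proposition letters, define $$ \begin{array}{lcl} \mathbf{QK} &=& \mathbf{QCl}\oplus \Box(p\to q)\to(\Box p\to\Box q),\\ \mathbf{QK4}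 &=& \mathbf{QK}\oplus \Box p\to\Box\Box p,\\ \mathbf{QS4} &=& \mathbf{QK4}\oplus \Box p\to p,\\ \mathbf{QS4.3} &=& \mathbf{QS4}\oplus \Box(\Box p\to q)\vee\Box(\Box q\to p),\\ \mathbf{QK4.3} &=& \mathbf{QK4}\oplus \Box(p\wedge\Box p\to q)\vee\Box(q\wedge\Box q\to p),\\ \mathbf{QK4.3.D.X} &=& \mathbf{QK4.3}\oplus \Diamond\top\oplus \Box\Box p\to\Box p. \end{array} $$ A predicate modal logic is a set of predicate modal formulas that includes $\mathbf{QK}$ and is closed under modus ponens, generalization, necessitation, and predicate substitution. $\Sigma^0_1$-hard means that every recursively enumerable set is many-one (computably) reducible to the set in question, formulas being identified with their codes under a standard effective coding. *)

(* Defs.v *)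
From mathcomp Require Import all_boot.
From mathcomp Require Import classical_sets.

Set Implicit Arguments.
Unset Strict Implicit.
Unset Printing Implicit Defensive.

Local Open Scope classical_set_scope.

(** * Predicate modal formulas *)

(* Individual variables are natural numbers.  A predicate letter is a pair
   (n, k) of an arity n and an index k; the atom with index k and argument list
   zs uses the letter (size zs, k), so that atoms of different lengths never
   share a letter. *)
Inductive form : Type :=
  | Atom of nat & seq nat
  | Top
  | Neg of form
  | And of form & form
  | Or of form & form
  | Imp of form & form
  | All of nat & form
  | Ex of nat & form
  | Box of form.

Definition Dia (f : form) : form := Neg (Box (Neg f)).

Fixpoint letters (f : form) : seq (nat * nat) :=
  match f with
  | Atom k zs => [:: (size zs, k)]
  | Top => [::]
  | Neg g | All _ g | Ex _ g | Box g => letters g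
  | And g h | Or g h | Imp g h => letters g ++ letters h
  end.

(* All variables, including those occurring only next to a quantifier. *)
Fixpoint vars (f : form) : seq nat :=
  match f with
  | Atom _ zs => zs
  | Top => [::]
  | Neg g | Box g => vars g
  | And g h | Or g h | Imp g h => vars g ++ vars h
  | All z g | Ex z g => z :: vars g
  end.

Fixpoint fv (f : form) : seq nat :=
  match f with
  | Atom _ zs => zs
  | Top => [::]
  | Neg g | Box g => fv g
  | And g h | Or g h | Imp g h => fv g ++ fv h
  | All z g | Ex z g => [seq w <- fv g | w != z]
  end.

(** * Classical first-order logic *)

Fixpoint box_free (f : form) : bool :=
  match f with
  | Atom _ _ | Top => true
  | Neg g | All _ g | Ex _ g => box_free g
  | And g h | Or g h | Imp g h => box_free g && box_free h
  | Box _ => false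
  end.

(* The restriction of I k to lists of size n interprets the letter (n, k).
   Only used on box-free formulas; the value at Box is irrelevant. *)
Fixpoint sat (D : Type) (I : nat -> seq D -> Prop) (v : nat -> D) (f : form)
    : Prop :=
  match f with
  | Atom k zs => I k (map v zs)
  | Top => True
  | Neg g => ~ sat I v g
  | And g h => sat I v g /\ sat I v h
  | Or g h => sat I v g \/ sat I v h
  | Imp g h => sat I v g -> sat I v h
  | All z g => forall d : D, sat I [eta v with z |-> d] g
  | Ex z g => exists d : D, sat I [eta v with z |-> d] g
  | Box _ => False
  end.

(* The assignment v forces the domain to be nonempty. *)
Definition QCl : set form :=
  [set f | box_free f /\
    forall (D : Type) (I : nat -> seq D -> Prop) (v : nat -> D), sat I v f].

(** * Predicate substitution *)

(* Replacement of the free occurrences of every variable w by s w. *)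
Fixpoint rename (s : nat -> nat) (f : form) : form :=
  match f with
  | Atom k zs => Atom k (map s zs)
  | Top => Top
  | Neg g => Neg (rename s g)
  | And g h => And (rename s g) (rename s h)
  | Or g h => Or (rename s g) (rename s h)
  | Imp g h => Imp (rename s g) (rename s h)
  | All z g => All z (rename [eta s with z |-> z] g)
  | Ex z g => Ex z (rename [eta s with z |-> z] g)
  | Box g => Box (rename s g)
  end.

(* No variable s w is captured by a quantifier of f in rename s f. *)
Fixpoint renamable (s : nat -> nat) (f : form) : bool :=
  match f with
  | Atom _ _ | Top => true
  | Neg g | Box g => renamable s g
  | And g h | Or g h | Imp g h => renamable s g && renamable s h
  | All z g | Ex z g =>
      all (fun w => (w == z) || (s w != z)) (fv g)
      && renamable [eta s with z |-> z] g
  end.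

(* The letter (n, k) is to be replaced by the formula body n k, in which the
   variables params n k stand for the n arguments.  The formula body n k may
   have further free variables. *)
Record psubst := PSubst {
  params : nat -> nat -> seq nat;
  body : nat -> nat -> form;
  size_params : forall n k, size (params n k) = n;
  uniq_params : forall n k, uniq (params n k) }.

(* Sends the i-th variable of xs to the i-th variable of zs, and fixes the
   variables outside xs, since index w xs = size zs for them. *)
Definition assign (xs zs : seq nat) (w : nat) : nat := nth w zs (index w xs).

Fixpoint psub (S : psubst) (f : form) : form :=
  match f with
  | Atom k zs =>
      rename (assign (params S (size zs) k) zs) (body S (size zs) k)
  | Top => Top
  | Neg g => Neg (psub S g)
  | And g h => And (psub S g) (psub S h)
  | Or g h => Or (psub S g) (psub S h)
  | Imp g h => Imp (psub S g) (psub S h)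
  | All z g => All z (psub S g)
  | Ex z g => Ex z (psub S g)
  | Box g => Box (psub S g)
  end.

(* Nothing is captured in psub S f, where bs lists the variables bound at the
   current position: the arguments of an atom are not captured by quantifiers
   of the formula replacing it, and the free variables of that formula other
   than its parameters are not captured by quantifiers of f. *)
Fixpoint capture_free (S : psubst) (bs : seq nat) (f : form) : bool :=
  match f with
  | Atom k zs =>
      let xs := params S (size zs) k in
      let g := body S (size zs) k in
      renamable (assign xs zs) g
      && all (fun b => (b \in xs) || (b \notin fv g)) bs
  | Top => true
  | Neg g | Box g => capture_free S bs g
  | And g h | Or g h | Imp g h => capture_free S bs g && capture_free S bs h
  | All z g | Ex z g => capture_free S (z :: bs) g
  end.

(** * Logics *)

Inductive oplus (G : set form) (a : form) : form -> Prop :=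
  | oplus_sub f : G f -> oplus G a f
  | oplus_ax : oplus G a a
  | oplus_mp f g : oplus G a f -> oplus G a (Imp f g) -> oplus G a g
  | oplus_gen x f : oplus G a f -> oplus G a (All x f)
  | oplus_nec f : oplus G a f -> oplus G a (Box f)
  | oplus_psub S f :
      capture_free S [::] f -> oplus G a f -> oplus G a (psub S f).

Definition ax_K : form :=
  let p := Atom 0 [::] in let q := Atom 1 [::] in
  Imp (Box (Imp p q)) (Imp (Box p) (Box q)).

Definition ax_4 : form :=
  let p := Atom 0 [::] in Imp (Box p) (Box (Box p)).

Definition ax_T : form :=
  let p := Atom 0 [::] in Imp (Box p) p.

Definition ax_S43 : form :=
  let p := Atom 0 [::] in let q := Atom 1 [::] in
  Or (Box (Imp (Box p) q)) (Box (Imp (Box q) p)).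

Definition ax_K43 : form :=
  let p := Atom 0 [::] in let q := Atom 1 [::] in
  Or (Box (Imp (And p (Box p)) q)) (Box (Imp (And q (Box q)) p)).

Definition ax_D : form := Dia Top.

Definition ax_X : form :=
  let p := Atom 0 [::] in Imp (Box (Box p)) (Box p).

(* The Barcan formula, with the variable 0 and the monadic letter (1, 0). *)
Definition bf : form :=
  let Px := Atom 0 [:: 0] in Imp (All 0 (Box Px)) (Box (All 0 Px)).

Definition QK : set form := oplus QCl ax_K.
Definition QK4 : set form := oplus QK ax_4.
Definition QS4 : set form := oplus QK4 ax_T.
Definition QS43 : set form := oplus QS4 ax_S43.
Definition QK43 : set form := oplus QK4 ax_K43.
Definition QK43DX : set form := oplus (oplus QK43 ax_D) ax_X.

Record modal_logic (L : set form) : Prop := ModalLogic {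
  modal_QK : QK `<=` L;
  modal_mp : forall f g, L f -> L (Imp f g) -> L g;
  modal_gen : forall x f, L f -> L (All x f);
  modal_nec : forall f, L f -> L (Box f);
  modal_psub : forall S f, capture_free S [::] f -> L f -> L (psub S f) }.

(* Every variable is x or y, and every letter is the monadic letter (1, P) or
   the proposition letter (0, p). *)
Definition in_fragment (x y P p : nat) (f : form) : Prop :=
  {subset vars f <= [:: x; y]} /\ {subset letters f <= [:: (1, P); (0, p)]}.

(** * Computability *)

(* Partial recursive functions of n arguments. *)
Inductive recf : nat -> Type :=
  | rzero : recf 0
  | rsucc : recf 1
  | rproj n (i : 'I_n) : recf n
  | rcomp m n (f : recf m) (g : 'I_m -> recf n) : recf n
  | rprec n (f : recf n) (g : recf n.+2) : recf n.+1
  | rmin n (f : recf n.+1) : recf n.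

(* recf_graph f v b: the partial function f is defined at v, with value b. *)
Fixpoint recf_graph n (f : recf n) : n.-tuple nat -> nat -> Prop :=
  match f in recf n return n.-tuple nat -> nat -> Prop with
  | rzero => fun _ b => b = 0
  | rsucc => fun v b => b = (thead v).+1
  | rproj _ i => fun v b => b = tnth v i
  | rcomp m _ f g => fun v b =>
      exists w : m.-tuple nat,
        (forall i, recf_graph (g i) v (tnth w i)) /\ recf_graph f w b
  | rprec _ f g => fun v b =>
      (* s lists the successive values of the primitive recursion *)
      exists s : nat -> nat,
        [/\ recf_graph f [tuple of behead v] (s 0),
            forall i, i < thead v ->
              recf_graph g [tuple of i :: s i :: behead v] (s i.+1)
          & b = s (thead v)]
  | rmin _ f => fun v b =>
      recf_graph f [tuple of b :: v] 0 /\
      forall i, i < b -> exists c, recf_graph f [tuple of i :: v] c.+1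
  end.

Definition computable (h : nat -> nat) : Prop :=
  exists c : recf 1, forall a, recf_graph c [tuple a] (h a).

Definition rec_enumerable (A : set nat) : Prop :=
  exists c : recf 1, forall a, A a <-> exists b, recf_graph c [tuple a] b.

Definition many_one_reducible (A B : set nat) : Prop :=
  exists2 h : nat -> nat, computable h & forall a, A a <-> B (h a).

Definition Sigma01_hard (B : set nat) : Prop :=
  forall A : set nat, rec_enumerable A -> many_one_reducible A B.

(** * Coding of formulas *)

(* Cantor's pairing function (a + b)(a + b + 1)/2 + b. *)
Definition cpair (a b : nat) : nat := 'C((a + b).+1, 2) + b.

Fixpoint code_seq (s : seq nat) : nat :=
  if s is z :: s' then (cpair z (code_seq s')).+1 else 0.

Fixpoint code (f : form) : nat :=
  match f with
  | Atom k zs => cpair 0 (cpair k (code_seq zs))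
  | Top => cpair 1 0
  | Neg g => cpair 2 (code g)
  | And g h => cpair 3 (cpair (code g) (code h))
  | Or g h => cpair 4 (cpair (code g) (code h))
  | Imp g h => cpair 5 (cpair (code g) (code h))
  | All z g => cpair 6 (cpair z (code g))
  | Ex z g => cpair 7 (cpair z (code g))
  | Box g => cpair 8 (code g)
  end.

Lemma cpair_inj a b c d : cpair a b = cpair c d -> a = c /\ b = d.
Proof.
have lt m n m' n' : m + n < m' + n' -> cpair m n < cpair m' n'.
  move=> h; rewrite /cpair.
  apply: (@leq_trans 'C((m' + n').+1, 2)); last exact: leq_addr.
  apply: (@leq_trans 'C((m + n).+2, 2)); last exact: leq_bin2l.
  by rewrite [X in _ < X]binS bin1 ltn_add2l ltnS leq_addl.
move=> e; case: (ltngtP (a + b) (c + d)) => [/lt|/lt|es].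
- by rewrite e ltnn.
- by rewrite e ltnn.
move: e; rewrite /cpair es => /addnI eb; split=> //.
by move: es; rewrite eb => /addIn.
Qed.

Lemma code_seq_inj : injective code_seq.
Proof.
elim=> [|z s IH] [|z' s'] //= [] /cpair_inj [-> /IH ->] //.
Qed.

Lemma code_inj : injective code.
Proof.
elim=> [k zs||g IHg|g IHg h IHh|g IHg h IHh|g IHg h IHh|z g IHg|z g IHg|g IHg];
  case=> [k' zs'||g'|g' h'|g' h'|g' h'|z' g'|z' g'|g'];
  move=> /cpair_inj [] // _.
- by move=> /cpair_inj [-> /code_seq_inj ->].
- by move=> /IHg ->.
- by move=> /cpair_inj [/IHg -> /IHh ->].
- by move=> /cpair_inj [/IHg -> /IHh ->].
- by move=> /cpair_inj [/IHg -> /IHh ->].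
- by move=> /cpair_inj [-> /IHg ->].
- by move=> /cpair_inj [-> /IHg ->].
- by move=> /IHg ->.
Qed.

(* Main.v *)
Require Import Defs.
From mathcomp Require Import all_boot.
From mathcomp Require Import classical_sets boolp.

(** Idea. All axioms in play hold in Kripke models with a constant domain and
    universal accessibility, so it suffices to find, for a recursively
    enumerable set A, formulas phi_n in the fragment that belong to QK when
    n is in A and fail in such a model otherwise.

    The graph of a partial recursive function is a term in the calculus of
    binary relations on binary words, built from the word constructors by
    composition, meet, converse and the least fixed points of
    Q = B u A;Q;C.  phi_n says that every family of binary relations closed
    under the corresponding Horn clauses relates the word of n to something.
    If n is in A, this follows from finitely many instances of the clauses;
    if not, the intended relations on words refute it.

    The clauses for composition need three or four variables.  With two
    variables they are stated inside a Box, where a marker predicate M singles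
    out the endpoint: from [](for all x (exists y (A x y and exists x (B y x
    and M x)) implies for all y (M y implies C x y))), the rigidity of A, B, C
    and Dia M(z) one derives, in QK, A u v and B v z imply C u z.

    Finally the relations are expressed by P and p.  The worlds with p give P
    the initial segments of a linear order, so x < y is Dia(p and P x and not
    P y); the first omega points are tokens, definable by their position.  A
    world without p gives P a token naming a relation and a pair of words,
    and < tells the two words apart. *)

Set Implicit Arguments.
Unset Strict Implicit.
Unset Printing Implicit Defensive.

Local Open Scope classical_set_scope.

(** * Recursive functions as terms of the calculus of relations *)

Inductive relt : Type :=
  | RNil
  | RCons of bool
  | RId
  | RComp of relt & relt
  | RMeet of relt & relt
  | RConv of relt
  | RLin of relt & relt & relt.

(* The least fixed point of Q = B u A;Q;C. *)
Inductive lin (T : Type) (A B C : T -> T -> Prop) : T -> T -> Prop :=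
  | lin_base p q : B p q -> lin A B C p q
  | lin_step p p' q' q : A p p' -> lin A B C p' q' -> C q' q -> lin A B C p q.

Fixpoint den (s : relt) (p q : seq bool) : Prop :=
  match s with
  | RNil => p = [::] /\ q = [::]
  | RCons b => q = b :: p
  | RId => p = q
  | RComp a b => exists2 r, den a p r & den b r q
  | RMeet a b => den a p q /\ den b p q
  | RConv a => den a q p
  | RLin a b c => lin (den a) (den b) (den c) p q
  end.

(* A number x becomes the block of x letters true closed by false, so that the
   letters act as a successor (true) and a push of 0 (false). *)
Fixpoint rep (v : seq nat) : seq bool :=
  if v is x :: v' then nseq x true ++ false :: rep v' else [::].

(** Exact in both directions: a stray output, even a word that codes no list, could be continued by
    a later composition. *)
Definition outs (a : relt) (p : seq bool) (A : seq nat -> Prop) : Prop :=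
  forall q, den a p q <-> exists2 u, A u & q = rep u.

Lemma block_inj j k p q :
  nseq j true ++ false :: p = nseq k true ++ false :: q -> j = k /\ p = q.
Proof. by elim: j k => [|j IH] [|k] //= [] // /IH [-> ->]. Qed.

Lemma rep_inj : injective rep.
Proof.
elim=> [|x u IH] [|y v] //=; [by case: y|by case: x|].
by case/block_inj=> -> /IH ->.
Qed.

Lemma outs_ext a p (A B : seq nat -> Prop) :
  (forall u, A u <-> B u) -> outs a p A -> outs a p B.
Proof.
move=> h ha q; rewrite ha.
by split=> -[u /h Bu ->]; exists u.
Qed.

Lemma outs_comp a b p A B : outs a p A ->
  (forall v, A v -> outs b (rep v) (B v)) ->
  outs (RComp a b) p (fun u => exists2 v, A v & B v u).
Proof.
move=> ha hb q; split=> [[r /ha [v Av ->]]|[u [v Av Bu] ->]].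
  by case/(hb v Av) => u Bu ->; exists u => //; exists v.
exists (rep v); first by apply/ha; exists v.
by apply/(hb v Av); exists u.
Qed.

Lemma outs_meet a b p A : outs a p A ->
  outs (RMeet a b) p (fun u => A u /\ den b p (rep u)).
Proof.
move=> ha q; split=> [[/ha [u Au ->] h]|[u [Au h] ->]]; first by exists u.
by split=> //; apply/ha; exists u.
Qed.

Lemma outs_id v : outs RId (rep v) (eq v).
Proof. by move=> q; split=> [/= <-|[u -> ->] //]; exists v. Qed.

(** With identities as base and as right factor, the linear fixed point is the reflexive transitive
    closure. *)
Definition star (a : relt) : relt := RLin a RId RId.

(** [Inv] confines the loop to lists on which the behaviour of [a] is known. *)
Lemma outs_star a (B : seq nat -> seq nat -> Prop) (Inv : seq nat -> Prop) v :
  (forall u, Inv u -> outs a (rep u) (B u)) ->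
  (forall u u', Inv u -> B u u' -> Inv u') ->
  Inv v -> outs (star a) (rep v) (lin B eq eq v).
Proof.
move=> ha hI Iv q; split.
  move=> h; change (lin (den a) eq eq (rep v) q) in h.
  move e: (rep v) h => p h; elim: h v e Iv => {p q} [p q <-|p p' q' q].
    by move=> v <- _; exists v => //; apply: lin_base.
  move=> pp' _ IH <- v e Iv; subst p; move: pp' => /(ha _ Iv) [u Bu eu].
  have [w lw ->] := IH u (esym eu) (hI _ _ Iv Bu).
  by exists w => //; apply: lin_step Bu lw _.
case=> u h ->; elim: h Iv => {v u} [v u <-|v v' u' u Bv _ IH <-] Iv /=.
  exact: lin_base.
apply: (@lin_step _ _ _ _ _ (rep v') (rep u')) => //.
  by apply/(ha _ Iv); exists v'.
exact: IH (hI _ _ Iv Bv).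
Qed.

(** The numbered chain matches the sequence of values by which [recf_graph] states primitive
    recursion, and gives access to all stages of a search. *)
Lemma lin_chain T (B : T -> T -> Prop) x y :
  lin B eq eq x y <->
  exists n (c : nat -> T),
    [/\ c 0 = x, c n = y & forall i, i < n -> B (c i) (c i.+1)].
Proof.
split=> [|[n [c [<- <- h]]]].
  elim=> {x y} [x y <-|x x' y' y Bx _ [n [c [c0 cn h]]] <-].
    by exists 0, (fun=> x).
  exists n.+1, (fun i => if i is i'.+1 then c i' else x); split=> // -[|i].
    by rewrite c0.
  by rewrite ltnS; apply: h.
elim: n c h => [|n IH] c h; first exact: lin_base.
apply: (@lin_step _ _ _ _ _ (c 1) (c n.+1)) => //; first exact: h.
by apply: (IH (c \o succn)) => i lt; apply: h.
Qed.

(** * List operations on words *)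

Definition rinc := RCons true.
Definition rpush := RCons false.
Definition rtl := RComp (star (RConv rinc)) (RConv rpush).
Definition rnilto := RComp (star rtl) RNil.
(** Each unfolding removes a letter true on the left and restores it on the right, so the first
    block survives, while the base discards everything after it. *)
Definition rhd :=
  RLin (RConv rinc) (RComp (RConv rpush) (RComp rnilto rpush)) rinc.

Lemma outs_push v : outs rpush (rep v) (eq (0 :: v)).
Proof. by move=> q; split=> [/= ->|[u <- ->] //]; exists (0 :: v). Qed.

Lemma outs_inc x v : outs rinc (rep (x :: v)) (eq (x.+1 :: v)).
Proof. by move=> q; split=> [/= ->|[u <- ->] //]; exists (x.+1 :: v). Qed.

Lemma outs_dec x v :
  outs (RConv rinc) (rep (x :: v)) (fun u => exists2 y, x = y.+1 & u = y :: v).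
Proof.
move=> q; split=> /= [|[u [y -> ->] ->] //].
by case: x => [|x] //= [<-]; exists (x :: v) => //; exists x.
Qed.

Lemma outs_pop x v :
  outs (RConv rpush) (rep (x :: v)) (fun u => x = 0 /\ u = v).
Proof.
move=> q; split=> /= [|[u [-> ->] ->] //].
by case: x => [|x] //= [<-]; exists v.
Qed.

Lemma den_strip p q :
  den (star (RConv rinc)) p q <-> exists j, p = nseq j true ++ q.
Proof.
split=> [h|[j ->]].
  have {h}: lin (fun p q : seq bool => p = true :: q) eq eq p q by [].
  elim=> {p q} [p q <-|p p' q' q -> _ [j ->] <-]; first by exists 0.
  by exists j.+1.
elim: j => [|j IH]; first exact: lin_base.
exact: (@lin_step _ _ _ _ _ (nseq j true ++ q) q).
Qed.

(** [rpair] runs [rtl] and [rhd] backwards, so both are described on arbitrary words, not only on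
    codes of lists. *)
Lemma den_tl p q : den rtl p q <-> exists j, p = nseq j true ++ false :: q.
Proof.
split=> [[r /den_strip [j ->] /= ->]|[j ->]]; first by exists j.
by exists (false :: q) => //; apply/den_strip; exists j.
Qed.

Lemma outs_tl x v : outs rtl (rep (x :: v)) (eq v).
Proof.
move=> q; rewrite den_tl; split=> [[j /block_inj [_ <-]]|[u <- ->]].
  by exists v.
by exists x.
Qed.

Lemma outs_nilto v : outs rnilto (rep v) (eq [::]).
Proof.
move=> q; split=> [[r _ [_ ->]]|[u <- ->]]; first by exists [::].
exists [::] => //; elim: v => [|x v IH]; first exact: lin_base.
apply: (@lin_step _ _ _ _ _ (rep v) [::]) => //.
by apply/outs_tl; exists v.
Qed.

Lemma den_hd p q : den rhd p q <->
  exists j r, [/\ p = nseq j true ++ false :: r, den rnilto r [::]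
    & q = rep [:: j]].
Proof.
split=> [h|[j [r [-> hr ->]]]].
  have {h}: lin (fun p q : seq bool => p = true :: q)
    (den (RComp (RConv rpush) (RComp rnilto rpush)))
    (fun p q : seq bool => q = true :: p) p q by [].
  elim=> {p q} [p q [r /= -> [r' hr ->]]|p p' q' q -> _ [j [r [-> hr ->]]] ->].
    exists 0, r; case: hr => r'' h [e ->]; split=> //; by exists r''.
  by exists j.+1, r.
elim: j => [|j IH].
  apply: lin_base; exists r => //; exists [::] => //.
exact: (@lin_step _ _ _ _ _ (nseq j true ++ false :: r) (rep [:: j])).
Qed.

Lemma outs_hd x v : outs rhd (rep (x :: v)) (eq [:: x]).
Proof.
move=> q; rewrite den_hd.
split=> [[j [r [/block_inj [-> _] _ ->]]]|[u <- ->]]; first by exists [:: j].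
by exists x, (rep v); split=> //; apply/outs_nilto; exists [::].
Qed.

(** The fork of [a] and [b], with [rhd] and [rtl] as projections. *)
Definition rpair (a b : relt) : relt :=
  RMeet (RComp a (RConv rhd)) (RComp b (RConv rtl)).

Lemma outs_pair a b p (A : nat -> Prop) B :
  outs a p (fun u => exists2 n, A n & u = [:: n]) -> outs b p B ->
  outs (rpair a b) p
    (fun u => exists n v, [/\ A n, B v & u = n :: v]).
Proof.
move=> ha hb q; split.
  case=> -[r /ha [u [n An ->] ->] hr] [r' /hb [v Bv ->] hr'].
  (* Head and tail give two decompositions of [q] at its first letter false; comparing them yields
     [q = rep (n :: v)]. *)
  have /den_hd [j [s [eq _ /rep_inj [ej]]]] : den rhd q (rep [:: n]) by [].
  have /den_tl [k] : den rtl q (rep v) by [].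
  rewrite eq => /block_inj [_ ->].
  by exists (n :: v) => //; [exists n, v|rewrite ej].
case=> u [n [v [An Bv ->]]] ->; split.
  exists (rep [:: n]); first by apply/ha; exists [:: n] => //; exists n.
  by apply/outs_hd; exists [:: n].
exists (rep v); first by apply/hb; exists v.
by apply/outs_tl; exists v.
Qed.

(** Following [a] and returning along its converse, met with the identity, leaves the identity on
    the domain of [a]. *)
Definition rtest (a : relt) : relt := RMeet RId (RComp a (RConv a)).

Lemma outs_test a v :
  outs (rtest a) (rep v) (fun u => u = v /\ exists q, den a (rep v) q).
Proof.
move=> q; split=> [[/= <- [r h _]]|[u [-> [r h]] ->]].
  by exists v => //; split=> //; exists r.
by split=> //; exists r.
Qed.

(** * Terms for the partial recursive functions *)

Definition implements n (f : recf n) (t : relt) : Prop :=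
  forall v : n.-tuple nat,
    outs t (rep v) (fun u => exists2 b, recf_graph f v b & u = [:: b]).

Lemma implements_zero : implements rzero rpush.
Proof.
move=> v; rewrite tuple0; apply: outs_ext (outs_push _) => u.
by split=> [<-|[b -> ->] //]; exists 0.
Qed.

Lemma implements_succ : implements rsucc rinc.
Proof.
case/tupleP=> x v; rewrite tuple0; apply: outs_ext (outs_inc _ _) => u.
split=> [<-|[b -> ->]]; first by exists x.+1.
by rewrite theadE.
Qed.

Fixpoint rnth (i : nat) : relt := if i is j.+1 then RComp rtl (rnth j) else rhd.

Lemma outs_nth v i : i < size v -> outs (rnth i) (rep v) (eq [:: nth 0 v i]).
Proof.
elim: v i => [|x v IH] [|i] //= lt; first exact: outs_hd.
apply: outs_ext (outs_comp (outs_tl x v) (B := fun=> eq [:: nth 0 v i]) _).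
  by move=> u; split=> [[w] //|<-]; exists v.
by move=> w <-; apply: IH.
Qed.

Lemma implements_proj n (i : 'I_n) : implements (rproj i) (rnth i).
Proof.
move=> v.
have lt : i < size v by rewrite size_tuple.
apply: outs_ext (outs_nth lt) => u; rewrite -tnth_nth.
by split=> [<-|[b -> ->] //]; exists (tnth v i).
Qed.

(** Iterated pairing over [enum 'I_m] collects the outputs of all [g i] in one list, to which the
    term of [f] is applied. *)
Lemma implements_comp m n (f : recf m) (g : 'I_m -> recf n) :
  (exists t, implements f t) -> (forall i, exists t, implements (g i) t) ->
  exists t, implements (rcomp f g) t.
Proof.
move=> [tf hf] hg.
(* Here [i] is only the default of [nth]; quantifying over it avoids choosing an element of ['I_m],
   which may be empty. *)
pose B (l : seq 'I_m) (v : n.-tuple nat) (u : seq nat) := size u = size l /\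
  forall i k, k < size l -> recf_graph (g (nth i l k)) v (nth 0 u k).
have [t ht] : exists t, forall v : n.-tuple nat,
    outs t (rep v) (B (enum 'I_m) v).
  elim: (enum 'I_m) => [|i l [t ht]].
    exists rnilto => v; apply: outs_ext (outs_nilto v) => u.
    by split=> [<-|[/size0nil ->]].
  have [ti hi] := hg i; exists (rpair ti t) => v.
  apply: outs_ext (outs_pair (hi v) (ht v)) => u; split.
    move=> [b [w [gb [sw h] ->]]]; split=> /= [|j [|k] lt //]; first by rewrite sw.
    exact: h.
  case: u => [|b w] [] //= [sw] h; exists b, w; split=> //; first exact: (h i 0).
  by split=> // j k lt; apply: (h j k.+1).
exists (RComp t tf) => v.
pose C (u w : seq nat) := exists2 b,
  (exists2 u' : m.-tuple nat, tval u' = u & recf_graph f u' b) & w = [:: b].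
apply: outs_ext (outs_comp (ht v) (B := C) _) => u.
  split.
    move=> [w [sw hw] [b [w' ew' fb] ->]]; exists b => //; exists w'; split=> // i.
    have := hw i i; rewrite -cardE card_ord ltn_ord nth_ord_enum => /(_ isT).
    by rewrite -ew' -tnth_nth.
  move=> [b [w [hw fb] ->]]; exists (tval w); last by exists b => //; exists w.
  split=> [|i k lt]; first by rewrite size_tuple -cardE card_ord.
  move: lt; rewrite -cardE card_ord => lt.
  have -> : nth i (enum 'I_m) k = Ordinal lt by exact: (nth_ord_enum i (Ordinal lt)).
  by have := hw (Ordinal lt); rewrite (tnth_nth 0).
case=> su _; have e : size u == m by rewrite su -cardE card_ord.
apply: outs_ext (hf (Tuple e)) => w; split=> [[b fb ->]|[b [u' eu fb] ->]]; exists b => //.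
  by exists (Tuple e).
by rewrite (_ : Tuple e = u') //; apply: val_inj.
Qed.

(** The loop runs on states made of a counter, the current value and the parameters. The bound is
    not part of the state: the meet in [run] keeps the final states whose counter equals the head of
    the input. *)
Lemma implements_prec n (f : recf n) (g : recf n.+2) :
  (exists t, implements f t) -> (exists t, implements g t) ->
  exists t, implements (rprec f g) t.
Proof.
move=> [tf hf] [tg hg].
pose start := RComp (RComp rtl (rpair tf RId)) rpush.
pose step := rpair (RComp rhd rinc) (rpair tg (RComp rtl rtl)).
pose run := RMeet (RComp start (star step)) (RComp rhd (RConv rhd)).
exists (RComp run (RComp rtl rhd)); case/tupleP=> t v.
pose B (X Y : seq nat) := exists i s b,
  [/\ X = i :: s :: v, recf_graph g [tuple of i :: s :: v] b
    & Y = i.+1 :: b :: v].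
pose Inv (X : seq nat) := exists i s, X = i :: s :: v.
have hstart : outs start (rep (t :: v))
    (fun u => exists2 s, recf_graph f v s & u = [:: 0, s & v]).
  have h1 w : v = w :> seq nat -> outs (rpair tf RId) (rep w)
      (fun u => exists2 s, recf_graph f v s & u = s :: v).
    move=> <-; apply: outs_ext (outs_pair (hf v) (outs_id v)) => u.
    by split=> [[s [w' [fs <- ->]]]|[s fs ->]]; [exists s|exists s, v].
  have h2 := outs_comp (outs_tl t v) h1.
  apply: outs_ext (outs_comp h2 (B := fun w => eq (0 :: w)) _) => u.
    split=> [[w [w' _ [s fs ->]] <-]|[s fs ->]]; first by exists s.
    by exists (s :: v) => //; exists v => //; exists s.
  by move=> _; apply: outs_push.
have hstep u : Inv u -> outs step (rep u) (B u).
  move=> [i [s ->]].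
  have h1 : outs (RComp rhd rinc) (rep [:: i, s & v])
      (fun u => exists2 j, j = i.+1 & u = [:: j]).
    apply: outs_ext (outs_comp (outs_hd _ _) (B := fun=> eq [:: i.+1]) _).
      move=> w; split=> [[_ _ <-]|[_ -> ->]]; last by exists [:: i].
      by exists i.+1.
    by move=> _ <-; apply: outs_inc.
  have h2 : outs (RComp rtl rtl) (rep [:: i, s & v]) (eq (tval v)).
    apply: outs_ext (outs_comp (outs_tl _ _) (B := fun=> eq (tval v)) _).
      by move=> w; split=> [[] //|<-]; exists (s :: v).
    by move=> _ <-; apply: outs_tl.
  apply: outs_ext (outs_pair h1 (outs_pair (hg [tuple of [:: i, s & v]]) h2)).
  move=> w; split.
    by move=> [_ [_ [-> [b [_ [gb <- ->]]] ->]]]; exists i, s, b.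
  move=> [_ [_ [b [[<- <-] gb ->]]]]; exists i.+1, (b :: v); split=> //.
  by exists b, v.
have hInv u u' : Inv u -> B u u' -> Inv u'.
  by move=> _ [i [s [b [_ _ ->]]]]; exists i.+1, b.
have hfin : outs (RComp rtl rhd) =1 outs (RComp rtl rhd) by [].
have hrun : outs run (rep (t :: v)) (fun u => exists s : nat -> nat,
    [/\ recf_graph f v (s 0), forall i, i < t ->
        recf_graph g [tuple of i :: s i :: v] (s i.+1)
      & u = [:: t, s t & v]]).
  have h := outs_comp hstart (B := lin B eq eq) _.
  apply: outs_ext (outs_meet _ (h _ _)) => [u|w]; last first.
    by move=> [s _ ->]; apply: outs_star hstep hInv _; exists 0, s.
  split.
    move=> [[w [s0 fs0 ->] /lin_chain [m [c [c0 cm hc]]]] [r]].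
    move=> /outs_hd [_ <- ->] ht.
    (* Entry 0 of a state is the counter, entry 1 the current value. *)
    pose s i := nth 0 (c i) 1.
    have cE i : i <= m -> c i = [:: i, s i & v].
      elim: i => [|i IH] lt; first by rewrite /s c0.
      have [j [s' [b [e _ e']]]] := hc i lt.
      by move: e; rewrite IH ?(ltnW lt) // => -[ej _]; rewrite /s e' -ej.
    have emt : m = t.
      move: ht; rewrite -cm cE // => /outs_hd [_ <- /rep_inj [->]] //.
    exists s; rewrite -emt; split=> [|i lt|]; last by rewrite -cm cE.
      by rewrite /s c0.
    have [j [s' [b [e gb e']]]] := hc i lt.
    move: e gb e'; rewrite cE ?(ltnW lt) // => -[<- <-] gb e'.
    by rewrite /s e'.
  move=> [s [fs gs ->]]; split.
    exists [:: 0, s 0 & v]; first by exists (s 0).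
    apply/lin_chain; exists t, (fun i => [:: i, s i & v]); split=> // i lt.
    by exists i, (s i), (s i.+1); split=> //; apply: gs.
  exists (rep [:: t]); first by apply/outs_hd; exists [:: t].
  by apply/outs_hd; exists [:: t].
have hres u : (exists s : nat -> nat, [/\ recf_graph f v (s 0),
    forall i, i < t -> recf_graph g [tuple of i :: s i :: v] (s i.+1)
    & u = [:: t, s t & v]]) ->
    outs (RComp rtl rhd) (rep u) (eq [:: nth 0 u 1]).
  move=> [s [_ _ ->]].
  apply: outs_ext (outs_comp (outs_tl _ _) (B := fun=> eq [:: s t]) _).
    by move=> w; split=> [[] //|<-]; exists (s t :: v).
  by move=> _ <-; apply: outs_hd.
have ev : [tuple of behead [tuple of t :: v]] = v by apply: val_inj.
apply: outs_ext (outs_comp hrun hres) => u; split.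
  move=> [w [s [fs gs ->]] <-]; exists (s t) => //=.
  exists s; split; rewrite ?theadE ?ev // => i lt.
  rewrite (_ : [tuple of _] = [tuple of i :: s i :: v]); first exact: gs.
  exact: val_inj.
move=> [b /= [s []]]; rewrite theadE ev => fs gs -> ->.
exists [:: t, s t & v] => //; exists s; split=> // i lt.
rewrite (_ : [tuple of _] = [tuple of i :: s i :: behead [tuple of t :: v]]).
  exact: gs.
exact: val_inj.
Qed.

(** A state is a candidate followed by the arguments. A step passes only if a successor can be
    undone on the value of [f], that is, if the value is positive; [fin] passes only if a pushed 0
    can be undone, that is, if the value is 0. *)
Lemma implements_min n (f : recf n.+1) :
  (exists t, implements f t) -> exists t, implements (rmin f) t.
Proof.
move=> [tf hf].
pose step := RComp (rtest (RComp tf (RConv rinc))) rinc.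
pose fin := rtest (RComp tf (RConv rpush)).
exists (RComp (RComp rpush (star step)) (RComp fin rhd)) => v.
pose B (X Y : seq nat) := exists i,
  [/\ X = i :: v, exists c, recf_graph f [tuple of i :: v] c.+1
    & Y = i.+1 :: v].
pose Inv (X : seq nat) := exists i, X = i :: v.
have hf' i : outs tf (rep (i :: v)) (fun u =>
    exists2 b, recf_graph f [tuple of i :: v] b & u = [:: b]).
  exact: (hf [tuple of i :: v]).
have hstep u : Inv u -> outs step (rep u) (B u).
  move=> [i ->].
  have h1 : outs (RComp tf (RConv rinc)) (rep (i :: v))
      (fun u => exists2 c, recf_graph f [tuple of i :: v] c.+1 & u = [:: c]).
    pose C (x w : seq nat) := exists2 c, x = [:: c.+1] & w = [:: c].
    apply: outs_ext (outs_comp (hf' i) (B := C) _) => w.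
      split=> [[_ [b fb ->] [c [eb] ->]]|[c fc ->]]; first by exists c; rewrite -?eb.
      by exists [:: c.+1]; [exists c.+1|exists c].
    move=> [b _ ->]; apply: outs_ext (outs_dec _ _) => w'.
    by split=> [[c -> ->]|[c [->] ->]]; exists c.
  apply: outs_ext (outs_comp (outs_test _ _) (B := fun=> eq (i.+1 :: v)) _).
    move=> w; split.
      by move=> [_ [_ [q /h1 [_ [c fc _] _]]] <-]; exists i; split=> //; exists c.
    move=> [_ [[<-] [c fc] ->]]; exists (i :: v) => //; split=> //.
    by exists (rep [:: c]); apply/h1; exists [:: c] => //; exists c.
  by move=> _ [-> _]; apply: outs_inc.
have hInv u u' : Inv u -> B u u' -> Inv u'.
  by move=> _ [i [_ _ ->]]; exists i.+1.
have hrun : outs (RComp rpush (star step)) (rep v)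
    (fun u => exists2 w, 0 :: v = w & lin B eq eq w u).
  apply: outs_comp (outs_push v) _ => _ <-.
  by apply: outs_star hstep hInv _; exists 0.
have hfin u : (exists2 w, 0 :: v = w & lin B eq eq w u) ->
    outs (RComp fin rhd) (rep u) (fun w =>
      exists2 b, u = b :: v /\ recf_graph f [tuple of b :: v] 0 & w = [:: b]).
  move=> [_ <- l].
  have [b eu] : Inv u.
    have : Inv (0 :: v) by exists 0.
    by elim: l => [p q <- //|p p' q' q Bp _ IH <- Ip]; apply: IH (hInv _ _ Ip Bp).
  subst u.
  have h1 : outs (RComp tf (RConv rpush)) (rep (b :: v))
      (fun u => recf_graph f [tuple of b :: v] 0 /\ u = [::]).
    pose C (x w : seq nat) := x = [:: 0] /\ w = [::].
    apply: outs_ext (outs_comp (hf' b) (B := C) _) => w.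
      split=> [[_ [c fc ->] [[ec] ->]]|[fc ->]]; first by rewrite -ec.
      by exists [:: 0] => //; exists 0.
    move=> [c _ ->]; apply: outs_ext (outs_pop _ _) => w'.
    by split=> [[-> ->]|[[->] ->]].
  apply: outs_ext (outs_comp (outs_test _ _) (B := fun=> eq [:: b]) _).
    move=> w; split.
      by move=> [_ [_ [q /h1 [_ [fb _] _]]] <-]; exists b.
    move=> [_ [[<-] fb] ->]; exists (b :: v) => //; split=> //.
    by exists [::]; apply/h1; exists [::].
  by move=> _ [-> _]; apply: outs_hd.
apply: outs_ext (outs_comp hrun hfin) => u; split.
  move=> [w [_ <- /lin_chain [m [c [c0 cm hc]]]] [b [ew fb] ->]].
  exists b => //; split=> //.
  have cE i : i <= m -> c i = i :: v.
    elim: i => [//|i IH] lt; have [j [e _ ->]] := hc i lt.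
    by move: e; rewrite IH ?(ltnW lt) // => -[->].
  have -> : b = m by move: ew; rewrite -cm cE // => -[].
  move=> i lt; have [j [e [d fd] _]] := hc i lt; exists d.
  by move: e fd; rewrite cE ?(ltnW lt) // => -[<-].
move=> [b [fb hb] ->]; exists (b :: v); last by exists b.
exists (0 :: v) => //; apply/lin_chain; exists b, (fun i => i :: v).
by split=> // i lt; exists i; split=> //; apply: hb.
Qed.

Lemma implementable n (f : recf n) : exists t, implements f t.
Proof.
elim: f => {n} [||n i|m n f IHf g IHg|n f IHf g IHg|n f IHf].
- by exists rpush; apply: implements_zero.
- by exists rinc; apply: implements_succ.
- by exists (rnth i); apply: implements_proj.
- exact: implements_comp.
- exact: implements_prec.
- exact: implements_min.
Qed.

(** * Models with universal accessibility, and derivations in a modal logic *)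

Lemma rename_fix (s : nat -> nat) g :
  {in fv g, forall w, s w = w} -> rename s g = g.
Proof.
elim: g s => [k zs||g IHg|g IHg h IHh|g IHg h IHh|g IHg h IHh|z g IHg|z g IHg|g IHg] s H /=.
- by congr Atom; rewrite -[RHS]map_id; apply/eq_in_map.
- by [].
- by rewrite IHg.
- by rewrite IHg ?IHh // => w i; apply: H; rewrite mem_cat i ?orbT.
- by rewrite IHg ?IHh // => w i; apply: H; rewrite mem_cat i ?orbT.
- by rewrite IHg ?IHh // => w i; apply: H; rewrite mem_cat i ?orbT.
- rewrite IHg // => w i /=; case: (eqVneq w z) => [-> //|n].
  by apply: H; rewrite mem_filter n.
- rewrite IHg // => w i /=; case: (eqVneq w z) => [-> //|n].
  by apply: H; rewrite mem_filter n.
- by rewrite IHg.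
Qed.

Lemma renamable_fix (s : nat -> nat) g :
  {in fv g, forall w, s w = w} -> renamable s g.
Proof.
elim: g s => [k zs||g IHg|g IHg h IHh|g IHg h IHh|g IHg h IHh|z g IHg|z g IHg|g IHg] s H //=.
- exact: IHg.
- by rewrite IHg ?IHh // => w i; apply: H; rewrite mem_cat i ?orbT.
- by rewrite IHg ?IHh // => w i; apply: H; rewrite mem_cat i ?orbT.
- by rewrite IHg ?IHh // => w i; apply: H; rewrite mem_cat i ?orbT.
- apply/andP; split.
    apply/allP=> w i; case: (eqVneq w z) => //= n.
    by rewrite H ?mem_filter ?n.
  apply: IHg => w i /=; case: (eqVneq w z) => [-> //|n].
  by apply: H; rewrite mem_filter n.
- apply/andP; split.
    apply/allP=> w i; case: (eqVneq w z) => //= n.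
    by rewrite H ?mem_filter ?n.
  apply: IHg => w i /=; case: (eqVneq w z) => [-> //|n].
  by apply: H; rewrite mem_filter n.
- exact: IHg.
Qed.

(* Kripke semantics with a constant domain and the universal accessibility
   relation; it validates every logic in the range of the theorem. *)
Fixpoint ksat (W D : Type) (I : W -> nat -> seq D -> Prop) (w : W)
    (v : nat -> D) (f : form) : Prop :=
  match f with
  | Atom k zs => I w k (map v zs)
  | Top => True
  | Neg g => ~ ksat I w v g
  | And g h => ksat I w v g /\ ksat I w v h
  | Or g h => ksat I w v g \/ ksat I w v h
  | Imp g h => ksat I w v g -> ksat I w v h
  | All z g => forall d : D, ksat I w [eta v with z |-> d] g
  | Ex z g => exists d : D, ksat I w [eta v with z |-> d] g
  | Box g => forall w' : W, ksat I w' v g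
  end.

Section Kripke.
Variables (W D : Type) (I : W -> nat -> seq D -> Prop).

Lemma ksat_ext w v v' f : {in fv f, v =1 v'} -> ksat I w v f <-> ksat I w v' f.
Proof.
elim: f w v v' => [k zs||g IHg|g IHg h IHh|g IHg h IHh|g IHg h IHh|z g IHg|z g IHg|g IHg] w v v' H /=.
- by have/eq_in_map -> : {in zs, v =1 v'} by [].
- by [].
- by rewrite (IHg w v v').
- by rewrite (IHg w v v') ?(IHh w v v') // => u i; apply: H; rewrite mem_cat i ?orbT.
- by rewrite (IHg w v v') ?(IHh w v v') // => u i; apply: H; rewrite mem_cat i ?orbT.
- by rewrite (IHg w v v') ?(IHh w v v') // => u i; apply: H; rewrite mem_cat i ?orbT.
- have E d : ksat I w [eta v with z |-> d] g <-> ksat I w [eta v' with z |-> d] g.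
    apply: IHg => u i /=; case: (eqVneq u z) => // n.
    by apply: H; rewrite mem_filter n.
  by split=> h d; apply/E.
- have E d : ksat I w [eta v with z |-> d] g <-> ksat I w [eta v' with z |-> d] g.
    apply: IHg => u i /=; case: (eqVneq u z) => // n.
    by apply: H; rewrite mem_filter n.
  by split=> -[d h]; exists d; apply/E.
- by split=> h w'; apply/(IHg w' v v' H).
Qed.

Lemma ksat_rename s w v f :
  renamable s f -> ksat I w v (rename s f) <-> ksat I w (v \o s) f.
Proof.
elim: f s w v => [k zs||g IHg|g IHg h IHh|g IHg h IHh|g IHg h IHh|z g IHg|z g IHg|g IHg] s w v /=.
- by rewrite -map_comp.
- by [].
- by move=> r; rewrite IHg.
- by case/andP=> rg rh; rewrite IHg ?IHh.
- by case/andP=> rg rh; rewrite IHg ?IHh.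
- by case/andP=> rg rh; rewrite IHg ?IHh.
- case/andP=> /allP a r.
  have E d : ksat I w [eta v with z |-> d] (rename [eta s with z |-> z] g) <->
      ksat I w [eta v \o s with z |-> d] g.
    rewrite IHg //; apply: ksat_ext => u i /=.
    case: (eqVneq u z) => [_|n]; first by rewrite eqxx.
    by have := a u i; rewrite (negbTE n) /= => /negbTE ->.
  by split=> h d; apply/E.
- case/andP=> /allP a r.
  have E d : ksat I w [eta v with z |-> d] (rename [eta s with z |-> z] g) <->
      ksat I w [eta v \o s with z |-> d] g.
    rewrite IHg //; apply: ksat_ext => u i /=.
    case: (eqVneq u z) => [_|n]; first by rewrite eqxx.
    by have := a u i; rewrite (negbTE n) /= => /negbTE ->.
  by split=> -[d h]; exists d; apply/E.
- by move=> r; split=> h w'; apply/IHg.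
Qed.

(** Outside [xs] the index is the length of [xs], so for [ds] of that length the default [v u] is
    returned. *)
Definition upd (v : nat -> D) (xs : seq nat) (ds : seq D) (u : nat) : D :=
  nth (v u) ds (index u xs).

Definition psub_interp (S : psubst) (v : nat -> D) (w : W) (k : nat)
    (ds : seq D) : Prop :=
  ksat I w (upd v (params S (size ds) k) ds) (body S (size ds) k).

(** [v0] fixes the variables of the bodies that are not parameters. Under quantifiers [v] departs
    from [v0] only on [bs], and [capture_free] keeps the variables in [bs] from being free in the
    bodies unless they are parameters. *)
Lemma ksat_psub_in S v0 bs w v f :
  capture_free S bs f -> (forall u, u \notin bs -> v u = v0 u) ->
  ksat I w v (psub S f) <-> ksat (psub_interp S v0) w v f.
Proof.
elim: f bs w v => [k zs||g IHg|g IHg h IHh|g IHg h IHh|g IHg h IHh|z g IHg|z g IHg|g IHg] bs w v /=.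
- case/andP=> r /allP a H; rewrite ksat_rename // /psub_interp size_map.
  apply: ksat_ext => u i; rewrite /= /assign /upd.
  case: (boolP (u \in params S (size zs) k)) => ui.
    have lt : index u (params S (size zs) k) < size zs.
      by rewrite -{2}(size_params S (size zs) k) index_mem.
    by rewrite (nth_map u).
  have e : index u (params S (size zs) k) = size zs.
    by rewrite -[RHS](size_params S (size zs) k); apply: memNindex.
  rewrite e !nth_default ?size_map // H //.
  by apply/negP=> /a; rewrite (negbTE ui) i.
- by [].
- by move=> c H; rewrite (IHg bs).
- by case/andP=> c c' H; rewrite (IHg bs) ?(IHh bs).
- by case/andP=> c c' H; rewrite (IHg bs) ?(IHh bs).
- by case/andP=> c c' H; rewrite (IHg bs) ?(IHh bs).
- move=> c H; have E d : ksat I w [eta v with z |-> d] (psub S g) <->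
      ksat (psub_interp S v0) w [eta v with z |-> d] g.
    apply: IHg c _ => u; rewrite inE negb_or /= => /andP [/negbTE -> ?].
    exact: H.
  by split=> h d; apply/E.
- move=> c H; have E d : ksat I w [eta v with z |-> d] (psub S g) <->
      ksat (psub_interp S v0) w [eta v with z |-> d] g.
    apply: IHg c _ => u; rewrite inE negb_or /= => /andP [/negbTE -> ?].
    exact: H.
  by split=> -[d h]; exists d; apply/E.
- by move=> c H; split=> h w'; apply/(IHg bs w' v).
Qed.

Lemma ksat_psub S w v f : capture_free S [::] f ->
  ksat I w v (psub S f) <-> ksat (psub_interp S v) w v f.
Proof. by move=> c; apply: ksat_psub_in c _. Qed.

Lemma ksat_box_free w v f : box_free f -> ksat I w v f <-> sat (I w) v f.
Proof.
elim: f v => [k zs||g IHg|g IHg h IHh|g IHg h IHh|g IHg h IHh|z g IHg|z g IHg|g IHg] v //=.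
- by move=> b; rewrite IHg.
- by case/andP=> b b'; rewrite IHg ?IHh.
- by case/andP=> b b'; rewrite IHg ?IHh.
- by case/andP=> b b'; rewrite IHg ?IHh.
- by move=> b; split=> h d; apply/IHg.
- by move=> b; split=> -[d h]; exists d; apply/IHg.
Qed.

End Kripke.

Definition kvalid : set form :=
  [set f | forall (W D : Type) (I : W -> nat -> seq D -> Prop) w v,
    ksat I w v f].

Lemma kvalid_oplus G a : G `<=` kvalid -> kvalid a -> oplus G a `<=` kvalid.
Proof.
move=> hG ha f; elim=> {f} [f /hG //|//|f g _ hf _ hg|x f _ hf|f _ hf|S f c _ hf]
  W D I w v.
- by have := hg W D I w v; apply; apply: hf.
- by move=> d; apply: hf.
- by move=> w'; apply: hf.
- by apply/ksat_psub => //; apply: hf.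
Qed.

Lemma kvalid_QCl : QCl `<=` kvalid.
Proof. by move=> f [b h] W D I w v; apply/ksat_box_free. Qed.

Lemma kvalid_QK4 : QK4 `<=` kvalid.
Proof.
apply: kvalid_oplus; first apply: kvalid_oplus; first exact: kvalid_QCl.
- by move=> W D I w v /= pq p w'; apply: pq.
- by move=> W D I w v /= p _.
Qed.

(** A boxed formula has the same truth value at all worlds, so in the linearity axiom either [Box p]
    fails everywhere or [p] holds everywhere. The constant domain gives the Barcan formula. *)
Lemma kvalid_S43_bf : oplus QS43 bf `<=` kvalid.
Proof.
apply: kvalid_oplus; last by move=> W D I w v /= h w' d; apply: h.
apply: kvalid_oplus.
  apply: kvalid_oplus; first exact: kvalid_QK4.
  by move=> W D I w v /=; apply.
move=> W D I w v /=.
have [p|p] := EM (forall w', I w' 0 [::]); first by right=> w' _.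
by left=> w' /p.
Qed.

Lemma kvalid_K43DX_bf : oplus QK43DX bf `<=` kvalid.
Proof.
apply: kvalid_oplus; last by move=> W D I w v /= h w' d; apply: h.
apply: kvalid_oplus; last by move=> W D I w v /= p; apply: p.
apply: kvalid_oplus; last by move=> W D I w v /= h; apply: (h w).
apply: kvalid_oplus; first exact: kvalid_QK4.
move=> W D I w v /=.
have [p|p] := EM (forall w', I w' 0 [::]); first by right=> w' _.
by left=> w' [_ /p].
Qed.

(** * Propositional and normal modal reasoning inside a logic *)

Lemma nullary_size (n : nat) (k : nat) : size (iota 0 n) = n.
Proof. exact: size_iota. Qed.

Lemma nullary_uniq (n : nat) (k : nat) : uniq (iota 0 n).
Proof. exact: iota_uniq. Qed.

Definition nullary_subst (F : nat -> form) : psubst :=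
  @PSubst (fun n _ => iota 0 n) (fun n k => if n is 0 then F k else Top)
    nullary_size nullary_uniq.

Fixpoint propositional (f : form) : bool :=
  match f with
  | Atom _ zs => nilp zs
  | Top => true
  | Neg g => propositional g
  | And g h | Or g h | Imp g h => propositional g && propositional h
  | _ => false
  end.

Section Logic.
Variables (L : set form) (hL : modal_logic L).

Lemma L_QCl : QCl `<=` L.
Proof. by move=> f q; apply: (modal_QK hL); apply: oplus_sub. Qed.

(** [QCl] is box-free, so modal instances have to come from substitution; as [f] has no quantifiers,
    no variable of [F] can be captured. *)
Lemma L_tautology F f : propositional f ->
  (forall D (I : nat -> seq D -> Prop) v, sat I v f) ->
  L (psub (nullary_subst F) f).
Proof.
move=> pf h; apply: (modal_psub hL); last first.
  apply: L_QCl; split=> //; elim: f pf {h} => //= g IHg h IHh /andP [] /IHg -> //.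
elim: f pf {h} => //= [k [] //= _|g IHg h IHh|g IHg h IHh|g IHg h IHh].
- by rewrite andbT renamable_fix.
- by case/andP=> /IHg -> /IHh ->.
- by case/andP=> /IHg -> /IHh ->.
- by case/andP=> /IHg -> /IHh ->.
Qed.

Let A k := Atom k [::].

Lemma L_and f g : L f -> L g -> L (And f g).
Proof.
move=> Lf Lg; apply: (modal_mp hL) Lg _; apply: (modal_mp hL) Lf _.
have := @L_tautology (nth Top [:: f; g]) (Imp (A 0) (Imp (A 1) (And (A 0) (A 1)))).
by rewrite /= !rename_fix //; apply.
Qed.

Lemma L_refl f : L (Imp f f).
Proof.
have := @L_tautology (nth Top [:: f]) (Imp (A 0) (A 0)).
by rewrite /= !rename_fix //; apply.
Qed.

Lemma L_comp f g h k :
  L (Imp f (Imp g h)) -> L (Imp h k) -> L (Imp f (Imp g k)).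
Proof.
move=> L1 L2; apply: (modal_mp hL) L2 _; apply: (modal_mp hL) L1 _.
have := @L_tautology (nth Top [:: f; g; h; k])
  (Imp (Imp (A 0) (Imp (A 1) (A 2)))
    (Imp (Imp (A 2) (A 3)) (Imp (A 0) (Imp (A 1) (A 3))))).
rewrite /= !rename_fix //; apply=> // D I v; exact: (fun pqr rs p q => rs (pqr p q)).
Qed.

Lemma L_K f g : L (Imp (Box (Imp f g)) (Imp (Box f) (Box g))).
Proof.
have : L (psub (nullary_subst (nth Top [:: f; g])) ax_K).
  apply: (modal_psub hL); last by apply: (modal_QK hL); apply: oplus_ax.
  by rewrite /= !renamable_fix.
by rewrite /= !rename_fix.
Qed.

(** Necessitation boxes the whole chain, and [L_K] then distributes the box over one premise at a
    time. *)
Lemma L_box_chain fs g : L (foldr Imp g fs) -> L (foldr Imp (Box g) (map Box fs)).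
Proof.
move=> h.
have {h}Lb : L (Box (foldr Imp g fs)) by apply: modal_nec.
suff : L (Imp (Box (foldr Imp g fs)) (foldr Imp (Box g) (map Box fs))).
  exact: modal_mp.
elim: fs {Lb} => [|f fs IH] /=; first exact: L_refl.
exact: L_comp (L_K _ _) IH.
Qed.

Lemma L_All_iter xs f : L f -> L (foldr All f xs).
Proof. by move=> Lf; elim: xs => //= x xs IH; apply: modal_gen. Qed.

End Logic.

(** * The reduction over binary letters *)

(** Gives each relation term a letter of its own. *)
Fixpoint rcode (s : relt) : nat :=
  match s with
  | RNil => cpair 0 0
  | RCons b => cpair 1 b
  | RId => cpair 2 0
  | RComp a b => cpair 3 (cpair (rcode a) (rcode b))
  | RMeet a b => cpair 4 (cpair (rcode a) (rcode b))
  | RConv a => cpair 5 (rcode a)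
  | RLin a b c => cpair 6 (cpair (rcode a) (cpair (rcode b) (rcode c)))
  end.

Lemma rcode_inj : injective rcode.
Proof.
elim=> [|b||a IHa b IHb|a IHa b IHb|a IHa|a IHa b IHb c IHc];
  case=> [|b'||a' b'|a' b'|a'|a' b' c'] /cpair_inj [] // _.
- by case: b b' => [] [].
- by case/cpair_inj=> /IHa -> /IHb ->.
- by case/cpair_inj=> /IHa -> /IHb ->.
- by move/IHa=> ->.
- by case/cpair_inj=> /IHa -> /cpair_inj [/IHb -> /IHc ->].
Qed.

(** Restricting the clauses to the subterms of one term keeps the formulas finite. *)
Fixpoint everywhere (F : relt -> form) (s : relt) : form :=
  match s with
  | RComp a b | RMeet a b =>
      And (F s) (And (everywhere F a) (everywhere F b))
  | RConv a => And (F s) (everywhere F a)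
  | RLin a b c =>
      And (F s) (And (everywhere F a) (And (everywhere F b) (everywhere F c)))
  | _ => F s
  end.

Lemma psub_everywhere S F s :
  psub S (everywhere F s) = everywhere (psub S \o F) s.
Proof.
elim: s => //= [a -> b ->|a -> b ->|a ->|a -> b -> c ->] //.
Qed.

Lemma ksat_everywhere W D (I : W -> nat -> seq D -> Prop) w v F s :
  (forall s, ksat I w v (F s)) -> ksat I w v (everywhere F s).
Proof. by move=> h; elim: s => //=; do !split=> //; apply: h. Qed.

(** For such bodies the provisos of substitution hold in every formula. *)
Definition tame (S : psubst) : Prop := forall n k,
  (forall s, renamable s (body S n k)) /\
  {subset fv (body S n k) <= params S n k}.

Lemma capture_free_tame S bs f : tame S -> capture_free S bs f.
Proof.
move=> hS; elim: f bs => //= [k zs|g IHg h IHh|g IHg h IHh|g IHg h IHh] bs.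
- have [r sub] := hS (size zs) k; rewrite r; apply/allP=> b _.
  by case: (boolP (b \in fv _)) => [/sub ->|]; rewrite ?orbT.
- by rewrite IHg IHh.
- by rewrite IHg IHh.
- by rewrite IHg IHh.
Qed.

Section Encoding.
Variables (x y : nat) (hxy : x <> y).

Let xyE : (x == y) = false. Proof. exact/eqP. Qed.
Let yxE : (y == x) = false. Proof. by rewrite eq_sym. Qed.

(** Unary and binary letters get [x] and [y] as parameters, so that the substituted bodies can stay
    within the two variables. *)
Definition xy_params (n k : nat) : seq nat :=
  match n with 1 => [:: x] | 2 => [:: x; y] | _ => iota 0 n end.

Lemma xy_params_size n k : size (xy_params n k) = n.
Proof. by case: n => [|[|[|n]]] //=; rewrite size_iota. Qed.

Lemma xy_params_uniq n k : uniq (xy_params n k).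
Proof.
case: n => [|[|[|n]]] //; first by rewrite /= inE xyE.
exact: (iota_uniq 0 n.+3).
Qed.

Lemma assign_x u v : assign [:: x; y] [:: u; v] x = u.
Proof. by rewrite /assign /= eqxx. Qed.

Lemma assign_y u v : assign [:: x; y] [:: u; v] y = v.
Proof. by rewrite /assign /= xyE eqxx. Qed.

Lemma assign_x1 u : assign [:: x] [:: u] x = u.
Proof. by rewrite /assign /= eqxx. Qed.

Definition R (s : relt) (u v : nat) := Atom (rcode s) [:: u; v].
Definition M (u : nat) := Atom 0 [:: u].

(* M marks the endpoint of the path, which frees a variable. *)
Definition marked_clause (s : relt) : form :=
  match s with
  | RComp a b =>
      All x (Imp (Ex y (And (R a x y) (Ex x (And (R b y x) (M x)))))
        (All y (Imp (M y) (R s x y))))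
  | RLin a b c =>
      All x (Imp (Ex y (And (R a x y) (Ex x (And (R s y x)
          (Ex y (And (R c x y) (M y)))))))
        (All y (Imp (M y) (R s x y))))
  | _ => Top
  end.

(* bR, nR, nM and bC stand for the boxed formulas []R, []~R, []~M and
   [](marked clauses), which box_subst below puts in their place; this leaves
   a classical formula. *)
Definition bR (s : relt) (u v : nat) := Atom (rcode s).*2 [:: u; v].
Definition nR (s : relt) (u v : nat) := Atom (rcode s).*2.+1 [:: u; v].
Definition nM (u : nat) := Atom 0 [:: u].
Definition bC := Atom 0 [::].

(** After [box_subst], an atom is necessarily true or necessarily false. The argument by K refutes
    necessary falsity, which leaves necessary truth. *)
Definition rigidity (s : relt) : form := All x (All y (Or (nR s x y) (bR s x y))).

Definition plain_clause (s : relt) : form :=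
  match s with
  | RMeet a b =>
      All x (All y (Imp (bR a x y) (Imp (bR b x y) (bR s x y))))
  | RConv a => All x (All y (Imp (bR a x y) (bR s y x)))
  | RLin a b c => All x (All y (Imp (bR b x y) (bR s x y)))
  | _ => Top
  end.

(* What K makes of a marked clause once the endpoint is named by a variable of
   its own. *)
Definition path_clause (s : relt) : form :=
  match s with
  | RComp a b => foldr All (foldr Imp (nM 2)
      [:: bC; bR a 0 1; bR b 1 2; nR s 0 2]) [:: 0; 1; 2]
  | RLin a b c => foldr All (foldr Imp (nM 3)
      [:: bC; bR a 0 1; bR s 1 2; bR c 2 3; nR s 0 3]) [:: 0; 1; 2; 3]
  | _ => Top
  end.

(** [RId x x] serves as the predicate of being a word, here and in the next two formulas. *)
Definition ex_nil : form := Ex x (And (bR RId x x) (bR RNil x x)).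
Definition ex_cons (b : bool) : form :=
  All x (Imp (bR RId x x) (Ex y (And (bR RId y y) (bR (RCons b) x y)))).
(** After [box_subst], every word is possibly marked. *)
Definition markable : form := All x (Imp (bR RId x x) (Neg (nM x))).

Fixpoint is_numeral (n : nat) : form :=
  match n with
  | 0 => Ex y (And (bR RNil y y) (bR (RCons false) y x))
  (* RId carries the predecessor from y back to x. *)
  | m.+1 =>
      Ex y (And (bR (RCons true) y x) (Ex x (And (bR RId x y) (is_numeral m))))
  end.

Definition hyps (t : relt) : form :=
  And bC (And ex_nil (And (ex_cons false) (And (ex_cons true) (And markable
    (And (everywhere rigidity t) (everywhere plain_clause t)))))).
Definition goal (t : relt) (n : nat) : form :=
  Ex x (And (is_numeral n) (Ex y (bR t x y))).

(** * The classical part of the derivation *)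

Section Classical.
Variables (D : Type) (I : nat -> seq D -> Prop) (v : nat -> D) (t : relt).
Hypothesis hpath : sat I v (everywhere path_clause t).
Hypothesis hhyps : sat I v (hyps t).

Let rB s d e := I (rcode s).*2 [:: d; e].

(** Choice picks a point for each word along the constructors. The rest is induction on the term
    and, for [RLin], on the derivation of [lin]: were a composite atom necessarily false, a path
    clause would make its endpoint unmarkable, against [markable]. *)
Lemma sat_hyps : exists can : seq bool -> D,
  [/\ forall p, rB RId (can p) (can p), rB RNil (can [::]) (can [::]),
      forall b p, rB (RCons b) (can p) (can (b :: p))
    & forall p q, den t p q -> rB t (can p) (can q)].
Proof.
case: hhyps => hC [hnil [hf [ht [hM [hrig hplain]]]]].
have [o [oI oN]] : exists o, rB RId o o /\ rB RNil o o.
  by case: hnil => o; rewrite /= eqxx; exists o.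
have hc b d : rB RId d d -> exists e, rB RId e e /\ rB (RCons b) d e.
  have : sat I v (ex_cons b) by case: b.
  by move=> /(_ d); rewrite /= eqxx => h /h [e]; rewrite /= !eqxx xyE; exists e.
have {hc} [c hc] : exists c : bool -> D -> D, forall b d, rB RId d d ->
    rB RId (c b d) (c b d) /\ rB (RCons b) d (c b d).
  have h b : exists c : D -> D, forall d, rB RId d d ->
      rB RId (c d) (c d) /\ rB (RCons b) d (c d).
    suff h' d : exists e, rB RId d d -> rB RId e e /\ rB (RCons b) d e.
      by have [f hff] := choice h'; exists f.
    have [/(hc b) [e he]|n] := EM (rB RId d d); first by exists e.
    (* A point that is no word gets an arbitrary value. *)
    by exists d.
  by have [f hff] := choice h; exists f.
pose can := foldr c o.
have canI p : rB RId (can p) (can p) by elim: p => //= b p /(hc b) [].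
have canC b p : rB (RCons b) (can p) (can (b :: p)) by have [] := hc b _ (canI p).
exists can; split=> // p q.
have hnM d : rB RId d d -> ~ I 0 [:: d].
  by move=> /= h; move: (hM d); rewrite /= eqxx; apply.
move: hpath hrig hplain p q; clear hhyps hpath.
elim: t => [|b||a IHa b IHb|a IHa b IHb|a IHa|a IHa b IHb c' IHc].
- by move=> _ _ _ p q [-> ->].
- by move=> _ _ _ p q ->.
- by move=> _ _ _ p q ->.
- move=> [h [ha hb]] [r [ra rb]] [_ [pa pb]] p q [m pm mq].
  have := r (can p) (can q); rewrite /= !eqxx xyE => -[nR|//].
  case: (hnM _ (canI q)); apply: h hC _ _ nR.
    exact: IHa pm.
  exact: IHb mq.
- move=> [h [ha hb]] [r [ra rb]] [h' [pa pb]] p q [pq1 pq2].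
  have := h' (can p) (can q); rewrite /= !eqxx xyE; apply.
    exact: IHa.
  exact: IHb.
- move=> [h ha] [r ra] [h' pa] p q pq.
  have := h' (can q) (can p); rewrite /= !eqxx xyE; apply.
  exact: IHa.
- move=> [h [ha [hb hc']]] [r [ra [rb rc]]] [h' [pa [pb pc]]] p q.
  elim=> {p q} [p q pq|p p' q' q pp' _ IH qq'].
    have := h' (can p) (can q); rewrite /= !eqxx xyE; apply.
    exact: IHb.
  have := r (can p) (can q); rewrite /= !eqxx xyE => -[nR|//].
  case: (hnM _ (canI q)); apply: (h (can p) (can p') (can q') (can q)) => //.
    exact: IHa.
  exact: IHc.
Qed.

Lemma sat_goal n q : den t (rep [:: n]) q -> sat I v (goal t n).
Proof.
have [can [canI canN canC canT]] := sat_hyps.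
move=> /canT h; exists (can (rep [:: n])); split; last first.
  by exists (can q); rewrite /= !eqxx xyE.
elim: n {h} v => [|n IH] v' /=.
  exists (can [::]); rewrite /= !eqxx xyE; split; first exact: canN.
  exact: (canC false [::]).
exists (can (rep [:: n])); rewrite /= !eqxx xyE; split; first exact: (canC true (rep [:: n])).
exists (can (rep [:: n])); rewrite /= ?eqxx ?yxE; split; first exact: canI.
exact: IH.
Qed.

End Classical.

(** * Substitution of the boxed formulas *)

Lemma fv_marked t : fv (everywhere marked_clause t) = [::].
Proof.
elim: t => //= [a -> b ->|a -> b ->|a -> b -> c ->];
  by do !rewrite /= ?eqxx ?xyE ?yxE.
Qed.

(** Halving and parity invert the doubled codes of [bR] and [nR]: even letters stand for atoms, odd
    ones for negated atoms. *)
Definition box_body (t : relt) (n k : nat) : form :=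
  match n with
  | 0 => Box (everywhere marked_clause t)
  | 1 => Box (Neg (M x))
  | 2 => Box (let f := Atom k./2 [:: x; y] in if odd k then Neg f else f)
  | _ => Top
  end.

Definition box_subst (t : relt) : psubst :=
  PSubst (box_body t) xy_params_size xy_params_uniq.

Lemma box_subst_tame t : tame (box_subst t).
Proof.
move=> [|[|[|n]]] k; split=> //=; try by case: (odd k).
- by move=> s; rewrite renamable_fix // fv_marked.
- by rewrite fv_marked.
Qed.

Lemma psub_bR t s u v : psub (box_subst t) (bR s u v) = Box (R s u v).
Proof. by rewrite /= odd_double doubleK /= assign_x assign_y. Qed.

Lemma psub_nR t s u v : psub (box_subst t) (nR s u v) = Box (Neg (R s u v)).
Proof. by rewrite /= odd_double /= uphalf_double assign_x assign_y. Qed.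

Lemma psub_nM t u : psub (box_subst t) (nM u) = Box (Neg (M u)).
Proof. by rewrite /= assign_x1. Qed.

Lemma psub_bC t : psub (box_subst t) bC = Box (everywhere marked_clause t).
Proof. by rewrite /= rename_fix // fv_marked. Qed.

Lemma psub_foldr_All S xs f : psub S (foldr All f xs) = foldr All (psub S f) xs.
Proof. by elim: xs => //= z xs ->. Qed.

Lemma psub_foldr_Imp S fs g :
  psub S (foldr Imp g fs) = foldr Imp (psub S g) (map (psub S) fs).
Proof. by elim: fs => //= f fs ->. Qed.

Lemma box_free_marked t : box_free (everywhere marked_clause t).
Proof. by elim: t => //= [a -> b ->|a -> b ->|a -> b -> c ->]. Qed.

(** * Derivation of the reduct in the logic *)

Section Derivation.
Variables (L : set form) (hL : modal_logic L) (t : relt).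

Let CC := everywhere marked_clause t.

(** The unboxed implication lies in [QCl]; K boxes its premises and its conclusion, and
    generalization adds the quantifiers. Only a classical entailment is left to check. *)
Lemma L_box_rule xs fs f g :
  box_free (foldr Imp (Neg f) (CC :: fs)) ->
  (forall D (I : nat -> seq D -> Prop) v,
    sat I v (foldr Imp (Neg f) (CC :: fs))) ->
  psub (box_subst t) g = foldr Imp (Box (Neg f)) (map Box (CC :: fs)) ->
  L (psub (box_subst t) (foldr All g xs)).
Proof.
move=> b h e; rewrite psub_foldr_All e.
apply: (L_All_iter hL); apply: (L_box_chain hL).
by apply: (L_QCl hL).
Qed.

(** Classically, a path together with the negation of its composite atom forces its end to be
    unmarked. The variables 0 to 3 are harmless: path clauses occur in the derivation, not in the
    reduct. *)
Lemma L_path_clauses : L (psub (box_subst t) (everywhere path_clause t)).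
Proof.
rewrite psub_everywhere.
have LTop : L Top by apply: (L_QCl hL).
suff sub s : (forall D (I : nat -> seq D -> Prop) v, sat I v CC ->
      sat I v (everywhere marked_clause s)) ->
    L (everywhere (psub (box_subst t) \o path_clause) s) by apply: sub.
elim: s => [|b||a IHa b IHb|a IHa b IHb|a IHa|a IHa b IHb c IHc] h //.
- apply: (L_and hL); last by apply: (L_and hL); [apply: IHa|apply: IHb];
    move=> D I v /h [_ []].
  apply: (@L_box_rule _ [:: R a 0 1; R b 1 2; Neg (R (RComp a b) 0 2)] (M 2)).
  + by rewrite /= /CC box_free_marked.
  + move=> D I v /= /h [/= h' _] ha hb nR m; apply: nR.
    have := h' (v 0); rewrite /= ?eqxx ?xyE ?yxE => h1.
    (* The clause rebinds [x] to the end of the path. If [v 2] is marked, it serves both as that end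
       and as the [y] of the conclusion. *)
    have := h1 _ (v 2); rewrite /= ?eqxx ?xyE ?yxE; apply => //.
    exists (v 1); rewrite /= ?eqxx ?xyE; split=> //.
    by exists (v 2); rewrite /= ?eqxx ?yxE.
  + by rewrite psub_foldr_Imp !map_cons psub_nM psub_bC !psub_bR psub_nR.
- by apply: (L_and hL) => //; apply: (L_and hL); [apply: IHa|apply: IHb];
    move=> D I v /h [_ []].
- by apply: (L_and hL) => //; apply: IHa => D I v /h [].
- apply: (L_and hL); last by apply: (L_and hL); [apply: IHa|apply: (L_and hL);
    [apply: IHb|apply: IHc]]; move=> D I v /h [_ [? []]].
  apply: (@L_box_rule _
    [:: R a 0 1; R (RLin a b c) 1 2; R c 2 3; Neg (R (RLin a b c) 0 3)] (M 3)).
  + by rewrite /= /CC box_free_marked.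
  + move=> D I v /= /h [/= h' _] ha hs hc nR m; apply: nR.
    have := h' (v 0); rewrite /= ?eqxx ?xyE ?yxE => h1.
    have := h1 _ (v 3); rewrite /= ?eqxx ?xyE ?yxE; apply => //.
    exists (v 1); rewrite /= ?eqxx ?xyE; split=> //.
    exists (v 2); rewrite /= ?eqxx ?yxE; split=> //.
    by exists (v 3); rewrite /= ?eqxx ?xyE.
  + by rewrite psub_foldr_Imp !map_cons psub_nM psub_bC !psub_bR psub_nR.
Qed.

Definition reduct (n : nat) : form := Imp (hyps t) (goal t n).

Lemma box_free_everywhere F s :
  (forall s, box_free (F s)) -> box_free (everywhere F s).
Proof.
by move=> h; elim: s => //= [a -> b ->|a -> b ->|a ->|a -> b -> c ->]; rewrite h.
Qed.

Lemma box_free_numeral n : box_free (is_numeral n).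
Proof. by elim: n. Qed.

(** With letters in place of the boxed formulas, the path clauses imply the reduct in [QCl];
    [box_subst] then restores the boxes. *)
Lemma L_reduct n q : den t (rep [:: n]) q -> L (psub (box_subst t) (reduct n)).
Proof.
move=> h; apply: (modal_mp hL) L_path_clauses _.
apply: (@modal_psub L hL (box_subst t) (Imp (everywhere path_clause t) (reduct n))).
  by apply: capture_free_tame; apply: box_subst_tame.
apply: (L_QCl hL); split=> [|D I v hp hh]; last exact: sat_goal hp hh _ _ h.
by rewrite /= box_free_numeral !box_free_everywhere //; case.
Qed.

End Derivation.
End Encoding.

(** * Elimination of the binary letters *)

Lemma vars_rename (a : pred nat) s g :
  (forall w, a w -> a (s w)) -> all a (vars g) -> all a (vars (rename s g)).
Proof.
elim: g s => //= [k zs|g IHg h IHh|g IHg h IHh|g IHg h IHh|z g IHg|z g IHg] s hs.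
- by rewrite all_map; apply: sub_all => w /= /hs.
- by rewrite !all_cat => /andP [/(IHg s hs) -> /(IHh s hs) ->].
- by rewrite !all_cat => /andP [/(IHg s hs) -> /(IHh s hs) ->].
- by rewrite !all_cat => /andP [/(IHg s hs) -> /(IHh s hs) ->].
- by move=> /andP [az ag]; rewrite az IHg // => w aw /=; case: eqP => // _; apply: hs.
- by move=> /andP [az ag]; rewrite az IHg // => w aw /=; case: eqP => // _; apply: hs.
Qed.

Lemma vars_psub (a : pred nat) S f : (forall n k, all a (vars (body S n k))) ->
  all a (vars f) -> all a (vars (psub S f)).
Proof.
move=> hS; elim: f => //= [k zs|g IHg h IHh|g IHg h IHh|g IHg h IHh|z g IHg|z g IHg].
- move=> /allP az; apply: vars_rename => // w aw; rewrite /assign.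
  have [lt|ge] := ltnP (index w (params S (size zs) k)) (size zs).
    by apply: az; apply: mem_nth.
  by rewrite nth_default.
- by rewrite !all_cat => /andP [/IHg -> /IHh ->].
- by rewrite !all_cat => /andP [/IHg -> /IHh ->].
- by rewrite !all_cat => /andP [/IHg -> /IHh ->].
- by move=> /andP [-> /IHg].
- by move=> /andP [-> /IHg].
Qed.

Lemma letters_rename s g : letters (rename s g) = letters g.
Proof.
elim: g s => //= [k zs|g IHg h IHh|g IHg h IHh|g IHg h IHh] s;
  by rewrite ?size_map ?IHg ?IHh.
Qed.

Lemma letters_psub (a : pred (nat * nat)) S f :
  (forall n k, all a (letters (body S n k))) -> all a (letters (psub S f)).
Proof.
move=> hS; elim: f => //= [k zs|g IHg h IHh|g IHg h IHh|g IHg h IHh].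
- by rewrite letters_rename.
- by rewrite all_cat IHg.
- by rewrite all_cat IHg.
- by rewrite all_cat IHg.
Qed.

Lemma ksat_Dia W D (I : W -> nat -> seq D -> Prop) w v f :
  ksat I w v (Dia f) <-> exists w', ksat I w' v f.
Proof.
split=> [h|[w' h] h']; last exact: (h' w').
by apply: contrapT => n; apply: h => w' h; apply: n; exists w'.
Qed.

Lemma ksat_And W D (I : W -> nat -> seq D -> Prop) w v f g :
  ksat I w v (And f g) <-> ksat I w v f /\ ksat I w v g.
Proof. by []. Qed.

Lemma ksat_Or W D (I : W -> nat -> seq D -> Prop) w v f g :
  ksat I w v (Or f g) <-> ksat I w v f \/ ksat I w v g.
Proof. by []. Qed.

(** * The intended model *)

Definition label (c d : nat) : nat := (cpair c d).+1.

Definition point : Type := (nat + seq bool)%type.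

(** Tokens come first, in order type omega, then the words by their [pickle] codes; so [inl j] is
    the only point with exactly [j] predecessors. *)
Definition ple (d e : point) : bool :=
  match d, e with
  | inl i, inl j => i <= j
  | inl _, inr _ => true
  | inr _, inl _ => false
  | inr u, inr v => pickle u <= pickle v
  end.

(** Cut worlds satisfy [p] and display the order; [WDat u] attests that [u] is a word and marks it;
    [WEdge s u v] displays a related pair. *)
Inductive world : Type :=
  | WCut of point
  | WDat of seq bool
  | WEdge of relt & seq bool & seq bool.

(* Worlds give P unordered pairs; the token records how the order of points
   relates the source u to the target v. *)
Definition direction (u v : seq bool) : nat :=
  if pickle u < pickle v then 0 else if pickle v < pickle u then 1 else 2.

(** An edge world of an unrelated pair has empty [P] and so shows no token. *)
Definition member (w : world) (d : point) : Prop :=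
  match w with
  | WCut e => ple d e
  | WDat u => d = inl 0 \/ d = inr u
  | WEdge s u v => den s u v /\
      [\/ d = inl (label (rcode s) (direction u v)), d = inr u | d = inr v]
  end.

Definition labelled (w : world) (l : nat) : Prop :=
  match w with
  | WCut _ => False
  | WDat _ => l = 0
  | WEdge s u v => den s u v /\ l = label (rcode s) (direction u v)
  end.

Definition model (w : world) (k : nat) (ds : seq point) : Prop :=
  match ds with
  | [::] => if w is WCut _ then True else False
  | [:: d] => member w d
  | _ => False
  end.

Lemma ple_trans d e f : ple d e -> ple e f -> ple d f.
Proof. by case: d e f => [i|u] [j|v] [k|w] //=; apply: leq_trans. Qed.

Lemma ple_refl d : ple d d.
Proof. by case: d => [i|u] /=. Qed.

Definition holds (s : relt) (d e : point) : Prop :=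
  exists u v, [/\ d = inr u, e = inr v & den s u v].

(** * Formulas for the order, the tokens and the relations *)

Section Encoding.
Variables (x y : nat) (hxy : x <> y) (P p : nat).

Let xyE : (x == y) = false. Proof. exact/eqP. Qed.
Let yxE : (y == x) = false. Proof. by rewrite eq_sym. Qed.

Let pP u := Atom P [:: u].
Let pp := Atom p [::].

Definition other (u : nat) : nat := if u == x then y else x.

Lemma other_neq u : (other u == u) = false.
Proof. by rewrite /other; case: (eqVneq u x) => [-> //|n]; rewrite eq_sym (negbTE n). Qed.

Definition before (u v : nat) : form := Dia (And pp (And (pP u) (Neg (pP v)))).

(** A descending chain of length [j] below [u], written with two alternating variables. *)
Fixpoint above (j u : nat) : form :=
  if j is i.+1 then Ex (other u) (And (before (other u) u) (above i (other u)))
  else Top.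

(* Closed, so that renaming u and v in the formulas below captures nothing. *)
Definition token (l : nat) : form :=
  And (Neg pp) (Ex x (And (pP x) (And (above l x) (Neg (above l.+1 x))))).

Definition data (u : nat) : form := Dia (And (token 0) (pP u)).

Definition edge (l u v : nat) : form := Dia (And (token l) (And (pP u) (pP v))).

(** At an edge world [P] contains the token besides the two words; [data] keeps the token from
    passing for a word. Comparing the order of [u] and [v] with the direction recorded in the label
    tells source from target. *)
Definition enc_rel (c u v : nat) : form :=
  And (data u) (And (data v)
    (Or (And (before u v) (edge (label c 0) u v))
    (Or (And (before v u) (edge (label c 1) u v))
        (And (And (Neg (before u v)) (Neg (before v u))) (edge (label c 2) u v))))).

(** Token 0 also lies in [P] at a data world; the conjunct for [RId] excludes it. *)
Definition enc_mark (u : nat) : form :=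
  And (token 0) (And (pP u) (enc_rel (rcode RId) u u)).

Definition enc_body (n c : nat) : form :=
  match n with 1 => enc_mark x | 2 => enc_rel c x y | _ => Top end.

Definition enc_subst : psubst :=
  PSubst enc_body (xy_params_size x y) (xy_params_uniq hxy).

Lemma fv_above j u : {subset fv (above j u) <= [:: u]}.
Proof.
elim: j u => [|j IH] u // w.
have -> : fv (above j.+1 u) =
    [seq z <- [:: other u, u & fv (above j (other u))] | z != other u] by [].
rewrite mem_filter !inE => /andP [/negbTE n]; rewrite n /= => /orP [//|/IH].
by rewrite inE n.
Qed.

Lemma fv_token l : fv (token l) = [::].
Proof.
apply/nilP; rewrite /nilp size_filter -leqn0 leqNgt -has_count -all_predC.
apply/allP=> w /=; rewrite negbK inE mem_cat => /or3P [//| |].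
  by move/fv_above; rewrite inE.
by move/(@fv_above l.+1); rewrite inE.
Qed.

Section Fragment.
Variables (a : pred nat) (b : pred (nat * nat)).
Hypotheses (ax : a x) (ay : a y) (bP : b (1, P)) (bp : b (0, p)).

Lemma vars_above j u : a u -> all a (vars (above j u)).
Proof.
elim: j u => [|j IH] u //= au.
have ao : a (other u) by rewrite /other; case: ifP.
by rewrite ao au IH.
Qed.

Lemma vars_token l : all a (vars (token l)).
Proof.
have -> : vars (token l) =
    [:: x, x & vars (above l x) ++ vars (above l.+1 x)] by [].
by rewrite -cat1s -(cat1s x (_ ++ _)) !all_cat !vars_above // all_seq1 ax.
Qed.

Lemma letters_above j u : all b (letters (above j u)).
Proof. by elim: j u => [|j IH] u //=; rewrite bP bp IH. Qed.

Lemma letters_token l : all b (letters (token l)).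
Proof.
have -> : letters (token l) =
    [:: (0, p), (1, P) & letters (above l x) ++ letters (above l.+1 x)] by [].
rewrite -cat1s -(cat1s (1, P) (_ ++ _)) !all_cat !letters_above !all_seq1.
by rewrite bP bp.
Qed.

End Fragment.

(** Only cuts satisfy [p], and they are initial segments; if any cut separates the two points, the
    one at [v a] does. *)
Lemma ksat_before w v a b : ksat model w v (before a b) <-> ~~ ple (v b) (v a).
Proof.
rewrite ksat_Dia; split=> [[[e|u|s u u'] [//= _ [h h']]]|h].
  by apply/negP=> h1; apply: h'; apply: ple_trans h1 h.
exists (WCut (v a)); split=> //=; split; first exact: ple_refl.
exact/negP.
Qed.

(** From any point at or beyond token [j.+1], the descent can continue at token [j]; words lie
    beyond all tokens. *)
Lemma ksat_above w v j u : ksat model w v (above j u) <-> ple (inl j) (v u).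
Proof.
elim: j u v => [|j IH] u v; first by split=> //; case: (v u).
split=> [[d [/ksat_before l /IH]]|h].
  move: l; rewrite /= eqxx (eq_sym u) other_neq.
  by case: (v u) d => [i|a] [k|b] /= /(_ w) //; rewrite -ltnNge => l le; apply: leq_ltn_trans l.
exists (inl j); split; [apply/ksat_before|apply/IH]; rewrite /= eqxx //.
by rewrite (eq_sym u) other_neq; case: (v u) h => [i|a] //=; rewrite -ltnNge.
Qed.

(** Having [l] but not [l.+1] points below singles out [inl l], and a world without [p] contains no
    token except its own. *)
Lemma ksat_token w v l : ksat model w v (token l) <-> labelled w l.
Proof.
have E (v' : nat -> point) j : ksat model w v' (above j x) <-> ple (inl j) (v' x).
  exact: ksat_above.
split.
  move=> [np [d [m [/E h h']]]].
  move: m h; rewrite /= eqxx => m h.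
  have {}h' : ~~ ple (inl l.+1) d.
    by apply/negP=> h1; apply/h'/(E _ l.+1); rewrite /= eqxx.
  have ed : d = inl l.
    by case: d {m} h h' => //= j lj; rewrite -leqNgt => jl; congr inl; apply/eqP; rewrite eqn_leq jl.
  subst d; case: w np m {E} => [e []//|u _ [] // [->] //|s a b _ [h1 [] // [->]]].
  by [].
move=> h; split; first by case: w h {E} => [e|u|s a b] h [].
exists (inl l); split.
  rewrite /= eqxx; case: w h {E} => [//|u /= ->|s a b [h ->]]; first by left.
  by split=> //; constructor.
split; first by apply/E; rewrite /= eqxx.
by move/(E _ l.+1); rewrite /= eqxx /= ltnn.
Qed.

(* Simplification would otherwise expand token l into l nested quantifiers. *)
Opaque token.

Lemma renamable_token s l : renamable s (token l).
Proof. by apply: renamable_fix; rewrite fv_token. Qed.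

Lemma renamable_enc_rel s c u v : renamable s (enc_rel c u v).
Proof. by rewrite /= !renamable_token. Qed.

Lemma fv_enc_rel c u v : {subset fv (enc_rel c u v) <= [:: u; v]}.
Proof.
move=> w; rewrite /= !fv_token !cat0s !mem_cat !in_cons in_nil.
by case: (w == u); case: (w == v).
Qed.

Lemma enc_subst_tame : tame enc_subst.
Proof.
move=> [|[|[|n]]] k; split; rewrite ?[body _ _ _]/=.
- by [].
- by [].
- by move=> s; rewrite /= !renamable_token.
- by move=> w; rewrite /= !fv_token !cat0s ?mem_cat !in_cons in_nil; case: (w == x).
- by move=> s; apply: renamable_enc_rel.
- exact: fv_enc_rel.
- by [].
- by [].
Qed.

Lemma enc_subst_vars (a : pred nat) n k :
  a x -> a y -> all a (vars (body enc_subst n k)).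
Proof.
move=> ax ay; have h l : all a (vars (token l)) by apply: vars_token.
by case: n => [|[|[|n]]] //; do 9!rewrite /= ?(all_cat, h, ax, ay).
Qed.

Lemma enc_subst_letters (b : pred (nat * nat)) n k :
  b (1, P) -> b (0, p) -> all b (letters (body enc_subst n k)).
Proof.
move=> bP bp; have h l : all b (letters (token l)) by apply: letters_token.
by case: n => [|[|[|n]]] //; do 9!rewrite /= ?(all_cat, h, bP, bp).
Qed.

(** Token 0 belongs to every data world, whence the first alternative; edge worlds drop out because
    their labels are positive. *)
Lemma ksat_data w v u :
  ksat model w v (data u) <-> v u = inl 0 \/ exists a, v u = inr a.
Proof.
rewrite ksat_Dia; split.
  move=> [w' /ksat_And [/ksat_token h m]].
  case: w' h m => //= [b _ [->|->]|s a b [] //]; first by left.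
  by right; exists b.
case=> [e|[a e]].
  by exists (WDat [::]); split; [apply/ksat_token|rewrite /= e; left].
by exists (WDat a); split; [apply/ksat_token|rewrite /= e; right].
Qed.

Lemma ksat_edge w v s k a b : ksat model w v (edge (label (rcode s) k) a b) <->
  exists c d, [/\ den s c d, direction c d = k,
    member (WEdge s c d) (v a) & member (WEdge s c d) (v b)].
Proof.
rewrite ksat_Dia; split.
  move=> [w' /ksat_And [/ksat_token h m]]; case: w' h m => // s' c d [dcd].
  by case=> /cpair_inj [/rcode_inj -> ->] [ma mb]; exists c, d.
move=> [c [d [dcd <- ma mb]]]; exists (WEdge s c d).
by split; [apply/ksat_token|split].
Qed.

(** A common edge world places both points among its two words. If one point precedes the other,
    order and direction leave only the right assignment; otherwise the direction shows that the two
    words are equal. *)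
Lemma ksat_enc_rel w v s a b :
  ksat model w v (enc_rel (rcode s) a b) <-> holds s (v a) (v b).
Proof.
split; last first.
  move=> [c [d [ea eb h]]]; split; first by apply/ksat_data; right; exists c.
  split; first by apply/ksat_data; right; exists d.
  have ab k : direction c d = k ->
      ksat model w v (edge (label (rcode s) k) a b).
    by move=> dk; apply/ksat_edge; exists c, d; rewrite ea eb; split=> //;
      split=> //; [constructor 2|constructor 3].
  have [lt1|ge1] := ltnP (pickle c) (pickle d).
    left; split; last by apply: ab; rewrite /direction lt1.
    by apply/ksat_before; rewrite ea eb /= -ltnNge.
  have [lt2|ge2] := ltnP (pickle d) (pickle c).
    right; left; split; last by apply: ab; rewrite /direction lt2 ltnNge ge1.
    by apply/ksat_before; rewrite ea eb /= -ltnNge.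
  right; right; split; last by apply: ab; rewrite /direction !ltnNge ge1 ge2.
  by split=> hl; have := proj1 (ksat_before w v _ _) hl; rewrite ea eb /= ?ge1 ?ge2.
move=> /ksat_And [/ksat_data da] /ksat_And [/ksat_data db].
(* The token of an edge world is positive, whereas [data] admits only token 0 and words. *)
have real z c d : member (WEdge s c d) (v z) ->
    v z = inl 0 \/ (exists a, v z = inr a) -> v z = inr c \/ v z = inr d.
  by move=> [_ [->|->|->]] [[]|[r []]] // _; [left|right].
case/ksat_Or=> [/ksat_And [/ksat_before l]|
  /ksat_Or [/ksat_And [/ksat_before l]|/ksat_And [_]]]
  /ksat_edge [c [d [h dk /real ma /real mb]]].
- have ltcd : pickle c < pickle d by move: dk; rewrite /direction; do !case: ifP.
  exists c, d.
  move: l; case: (ma da) => ->; case: (mb db) => -> //=; by rewrite ?leqnn // (ltnW ltcd).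
- have ltdc : pickle d < pickle c.
    by move: dk; rewrite /direction; case: ifP => // _; case: ifP.
  exists c, d.
  move: l; case: (ma da) => ->; case: (mb db) => -> //=; by rewrite ?leqnn // (ltnW ltdc).
- have ecd : c = d.
    apply: (pcan_inj pickleK); apply/eqP; move: dk; rewrite /direction.
    by case: ltngtP.
  subst d; exists c, c; by case: (ma da) => ->; case: (mb db) => ->.
Qed.

Lemma ksat_enc_mark w v a :
  ksat model w v (enc_mark a) <-> exists2 u, w = WDat u & v a = inr u.
Proof.
split=> [/ksat_And [/ksat_token h /ksat_And [m /ksat_enc_rel [u [_ [e _ _]]]]]|[u -> e]].
  case: w h m => //= [u' _|s b c [] //]; rewrite e => -[//|[->]].
  by exists u'.
split; first by apply/ksat_token.
by split; [rewrite /= e; right|apply/ksat_enc_rel; exists u, u].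
Qed.

(** * The refuting interpretation *)

Section Model.
Variables (w : world) (v : nat -> point) (t : relt).

Let J1 := psub_interp model enc_subst v.

Lemma enc_interp_rel w' s d e : J1 w' (rcode s) [:: d; e] <-> holds s d e.
Proof.
rewrite /J1 /psub_interp ksat_enc_rel.
by rewrite /upd /= eqxx xyE eqxx.
Qed.

Lemma enc_interp_mark w' d : J1 w' 0 [:: d] <-> exists2 u, w' = WDat u & d = inr u.
Proof.
rewrite /J1 /psub_interp ksat_enc_mark.
by rewrite /upd /= eqxx.
Qed.

Let J2 := psub_interp J1 (box_subst hxy t) v.

(** [holds] does not depend on the world, so the box adds nothing. *)
Lemma box_interp_bR w' s d e : J2 w' (rcode s).*2 [:: d; e] <-> holds s d e.
Proof.
rewrite /J2 /psub_interp /= odd_double doubleK /upd /= eqxx xyE eqxx.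
by split=> [/(_ w) /enc_interp_rel|h w''] //; apply/enc_interp_rel.
Qed.

Lemma box_interp_nR w' s d e : J2 w' (rcode s).*2.+1 [:: d; e] <-> ~ holds s d e.
Proof.
rewrite /J2 /psub_interp /= odd_double /= uphalf_double /upd /= eqxx xyE eqxx.
by split=> [/(_ w) h /enc_interp_rel|h w'' /enc_interp_rel].
Qed.

(** Each word is marked at its own data world, and no other point is ever marked. *)
Lemma box_interp_nM w' d : J2 w' 0 [:: d] <-> ~ exists u, d = inr u.
Proof.
rewrite /J2 /psub_interp /= /upd /= eqxx.
split=> [h [u e]|h w'' /enc_interp_mark [u _ e]]; last by apply: h; exists u.
by apply: (h (WDat u)); apply/enc_interp_mark; exists u.
Qed.

(** At most one point is marked at a given world, so the marked end of the path and the marked [y]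
    of the conclusion coincide; the clause then reduces to composition or to [lin_step]. *)
Lemma box_interp_bC w' : J2 w' 0 [::].
Proof.
change (forall w'', ksat J1 w'' (upd v [::] [::])
  (everywhere (marked_clause x y) t)).
move=> w''; apply: ksat_everywhere => -[|b||a b|a b|a|a b c]; try exact: I.
- move=> d [e [ha [f [hb hm]]]] g hg.
  move: ha hb hm hg; rewrite /= !eqxx ?xyE ?yxE.
  move=> /enc_interp_rel [u [u' [-> eu hu]]] /enc_interp_rel [u1 [u2 [e1 ef hu1]]].
  move=> /enc_interp_mark [z ez ef'] /enc_interp_mark [z' ez' ->].
  move: e1 ef ez' hu1; rewrite eu ef' ez => -[<-] [->] [->] hu1.
  by apply/(enc_interp_rel _ (RComp a b)); exists u, z'; split=> //; exists u'.
- move=> d [e [ha [d' [hl [e' [hc hm]]]]]] g hg.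
  move: ha hl hc hm hg; rewrite /= !eqxx ?xyE ?yxE.
  move=> /enc_interp_rel [u [u1 [-> e1 h1]]] /(enc_interp_rel _ (RLin a b c)) [u2 [u3 [e2 e3 h2]]].
  move=> /enc_interp_rel [u4 [u5 [e4 e5 h3]]].
  move=> /enc_interp_mark [z ez ef'] /enc_interp_mark [z' ez' ->].
  move: e2 e4 e5 ez' h2 h3; rewrite e1 e3 ef' ez => -[<-] [<-] [->] [->] h2 h3.
  apply/(enc_interp_rel _ (RLin a b c)); exists u, z'; split=> //.
  exact: lin_step h1 h2 h3.
Qed.

Lemma ksat_numeral n v' : ksat J2 w v' (is_numeral x y n) ->
  v' x = inr (rep [:: n]).
Proof.
elim: n v' => [|n IH] v'.
  move=> [d [h1 h2]]; move: h1 h2; rewrite /= !eqxx ?xyE.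
  move=> /(box_interp_bR _ RNil) [u [_ [-> _ [-> _]]]].
  by move=> /(box_interp_bR _ (RCons false)) [_ [u' [[<-] -> ->]]].
move=> [d [h1 [e [h2 /IH h3]]]]; move: h1 h2 h3; rewrite /= !eqxx ?xyE ?yxE.
move=> /(box_interp_bR _ (RCons true)) [u [u' [-> -> ->]]].
by move=> /(box_interp_bR _ RId) [u1 [_ [-> [<-] <-]]] [->].
Qed.

(** The intended relations satisfy the hypotheses, so the goal holds; there [x] can only be the word
    of [n]. *)
Lemma refutation n :
  ksat model w v (psub enc_subst (psub (box_subst hxy t) (reduct x y t n))) ->
  exists q, den t (rep [:: n]) q.
Proof.
move/ksat_psub => /(_ (capture_free_tame _ _ enc_subst_tame)).
move/ksat_psub => /(_ (capture_free_tame _ _ (box_subst_tame _ _))) h.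
have /h : ksat J2 w v (hyps x y t).
  have hId (d : point) : J2 w (rcode RId).*2 [:: d; d] -> exists u, d = inr u.
    by move=> /(box_interp_bR _ RId) [u [_ [-> _ _]]]; exists u.
  have hcons b : ksat J2 w v (ex_cons x y b).
    move=> d h1; move: h1; rewrite /= eqxx => /hId [u ->].
    exists (inr (b :: u)); rewrite /= !eqxx xyE; split.
      by apply/(box_interp_bR _ RId); exists (b :: u), (b :: u).
    by apply/(box_interp_bR _ (RCons b)); exists u, (b :: u).
  split; first exact: box_interp_bC.
  split.
    exists (inr [::]); rewrite /= eqxx; split.
      by apply/(box_interp_bR _ RId); exists [::], [::].
    by apply/(box_interp_bR _ RNil); exists [::], [::].
  split; first exact: hcons.
  split; first exact: hcons.
  split.
    by move=> d /= ; rewrite eqxx => /hId hd /box_interp_nM.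
  split; apply: ksat_everywhere => s.
    move=> d e; rewrite /= !eqxx xyE.
    by have [hs|hs] := EM (holds s d e); [right; apply/box_interp_bR|left; apply/box_interp_nR].
  case: s => [|b||a b|a b|a|a b c]; try exact: I; move=> d e; rewrite /= !eqxx ?xyE.
  - move=> /box_interp_bR [u [u' [-> -> ua]]] /box_interp_bR [_ [_ [[<-] [<-] ub]]].
    by apply/(box_interp_bR _ (RMeet a b)); exists u, u'.
  - move=> /box_interp_bR [u [u' [-> -> ua]]].
    by apply/(box_interp_bR _ (RConv a)); exists u', u.
  - move=> /box_interp_bR [u [u' [-> -> ub]]].
    apply/(box_interp_bR _ (RLin a b c)); exists u, u'; split=> //; exact: lin_base.
move=> [d [/ksat_numeral hd [e he]]]; move: hd he; rewrite /= !eqxx xyE => ->.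
by move=> /box_interp_bR [u [q [[<-] _ hq]]]; exists q.
Qed.

End Model.

Lemma vars_everywhere (a : pred nat) F s :
  (forall s, all a (vars (F s))) -> all a (vars (everywhere F s)).
Proof.
by move=> h; elim: s => //= [b hb c hc|b hb c hc|b hb|b hb c hc d hd];
  rewrite !all_cat h ?hb ?hc ?hd.
Qed.

Lemma vars_reduct (a : pred nat) t n :
  a x -> a y -> all a (vars (reduct x y t n)).
Proof.
move=> ax ay.
have hn : all a (vars (is_numeral x y n)).
  by elim: n => [|n IH]; rewrite /= ?ax ?ay ?IH.
have hr : all a (vars (everywhere (rigidity x y) t)).
  by apply: vars_everywhere => s; rewrite /= ax ay.
have hp : all a (vars (everywhere (plain_clause x y) t)).
  by apply: vars_everywhere => -[|b||b c|b c|b|b c d] //=; rewrite ax ay.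
by do 9!rewrite /= ?(all_cat, hn, hr, hp, ax, ay).
Qed.

Lemma box_subst_vars (a : pred nat) t n k :
  a x -> a y -> all a (vars (body (box_subst hxy t) n k)).
Proof.
move=> ax ay; case: n => [|[|[|n]]] //=; last by case: (odd k); rewrite /= ax ay.
  by apply: vars_everywhere => -[|b||b c|b c|b|b c d] //=; rewrite ax ay.
by rewrite ax.
Qed.

Lemma enc_in_fragment t n :
  in_fragment x y P p
    (psub enc_subst (psub (box_subst hxy t) (reduct x y t n))).
Proof.
split; apply/allP.
  have hx : x \in [:: x; y] by rewrite inE eqxx.
  have hy : y \in [:: x; y] by rewrite !inE eqxx orbT.
  apply: vars_psub => [m k|]; first exact: enc_subst_vars.
  apply: vars_psub => [m k|]; first exact: box_subst_vars.
  exact: vars_reduct.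
by apply: letters_psub => m k; apply: enc_subst_letters;
  rewrite /= !inE eqxx ?orbT.
Qed.

End Encoding.

(** * Computability of the reduction *)

Definition computable_fun n (f : n.-tuple nat -> nat) : Prop :=
  exists c : recf n, forall v, recf_graph c v (f v).

Lemma computable_proj n (i : 'I_n) : computable_fun (fun v => tnth v i).
Proof. by exists (rproj i). Qed.

Lemma computable_comp m n (f : m.-tuple nat -> nat)
    (g : 'I_m -> n.-tuple nat -> nat) :
  computable_fun f -> (forall i, computable_fun (g i)) ->
  computable_fun (fun v => f [tuple g i v | i < m]).
Proof.
move=> [cf hf] /choice [cg hg]; exists (rcomp cf cg) => v.
exists [tuple g i v | i < m]; split=> [i|]; last exact: hf.
by rewrite tnth_mktuple; apply: hg.
Qed.

Lemma computable_succ n (f : n.-tuple nat -> nat) :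
  computable_fun f -> computable_fun (fun v => (f v).+1).
Proof.
move=> hf.
have hs : computable_fun (fun v : 1.-tuple nat => (thead v).+1) by exists rsucc.
have [c hc] := computable_comp hs (fun _ : 'I_1 => hf); exists c => v.
by have := hc v; rewrite /thead tnth_mktuple.
Qed.

Lemma computable_const n k : computable_fun (fun _ : n.-tuple nat => k).
Proof.
elim: k => [|k IH]; last exact: computable_succ.
have h0 : computable_fun (fun _ : 0.-tuple nat => 0) by exists rzero.
by apply: (computable_comp h0 (g := fun=> fun=> 0)) => -[].
Qed.

Lemma computable_prec n (f : n.-tuple nat -> nat) (g : n.+2.-tuple nat -> nat)
    (F : n.-tuple nat -> nat -> nat) :
  computable_fun f -> computable_fun g -> (forall w, F w 0 = f w) ->
  (forall w i, F w i.+1 = g [tuple of i :: F w i :: w]) ->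
  computable_fun (fun v : n.+1.-tuple nat => F [tuple of behead v] (thead v)).
Proof.
move=> [cf hf] [cg hg] F0 FS; exists (rprec cf cg) => v.
exists (F [tuple of behead v]); split=> [|i _|//]; first by rewrite F0; apply: hf.
rewrite FS (_ : [tuple of i :: _ :: behead v] =
  [tuple of i :: F [tuple of behead v] i :: [tuple of behead v]]); first exact: hg.
exact: val_inj.
Qed.

Lemma computable_comp2 n (F : nat -> nat -> nat) (f g : n.-tuple nat -> nat) :
  computable_fun (fun v : 2.-tuple nat => F (tnth v ord0) (tnth v ord_max)) ->
  computable_fun f -> computable_fun g ->
  computable_fun (fun v => F (f v) (g v)).
Proof.
move=> hF hf hg.
have h (i : 'I_2) : computable_fun (fun v => if i == ord0 then f v else g v).
  by case: (i == ord0).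
have [c hc] := computable_comp hF h; exists c => v.
by have := hc v; rewrite !tnth_mktuple.
Qed.

Lemma computable_add n (f g : n.-tuple nat -> nat) :
  computable_fun f -> computable_fun g -> computable_fun (fun v => f v + g v).
Proof.
apply: computable_comp2.
have [|c hc] := computable_prec (F := fun w i => i + tnth w ord0)
  (computable_proj (ord0 : 'I_1))
  (computable_succ (computable_proj (inord 1 : 'I_3))) (fun=> erefl).
  by move=> w i; rewrite addSn !(tnth_nth 0) inordK.
exists c => v; have := hc v.
by case/tupleP: v => a v; case/tupleP: v => b v; rewrite /thead !(tnth_nth 0).
Qed.

(** Triangular numbers obey a primitive recursion: the next one is [i.+1] plus the current one. *)
Lemma computable_triangle n (f : n.-tuple nat -> nat) :
  computable_fun f -> computable_fun (fun v => 'C((f v).+1, 2)).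
Proof.
move=> hf.
have h : computable_fun (fun v : 1.-tuple nat => 'C((thead v).+1, 2)).
  apply: (computable_prec (F := fun _ i => 'C(i.+1, 2)) (computable_const 0 0)
    (computable_add (computable_succ (computable_proj (ord0 : 'I_2)))
      (computable_proj (ord_max : 'I_2)))) => // w i.
  by rewrite binS bin1 addnC !(tnth_nth 0).
have [c hc] := computable_comp h (fun _ : 'I_1 => hf); exists c => v.
by have := hc v; rewrite /thead tnth_mktuple.
Qed.

Lemma computable_cpair n (f g : n.-tuple nat -> nat) :
  computable_fun f -> computable_fun g ->
  computable_fun (fun v => cpair (f v) (g v)).
Proof.
move=> hf hg; apply: computable_add => //; apply: computable_triangle.
exact: computable_add.
Qed.

Lemma computable_iter (F : nat -> nat) k :
  computable_fun (fun v : 1.-tuple nat => F (thead v)) ->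
  computable_fun (fun v : 1.-tuple nat => iter (thead v) F k).
Proof.
move=> hF.
have h : computable_fun (fun v : 2.-tuple nat => F (tnth v ord_max)).
  have [c hc] := computable_comp hF (fun _ : 'I_1 => computable_proj (ord_max : 'I_2)).
  by exists c => v; have := hc v; rewrite /thead tnth_mktuple.
by apply: (computable_prec (F := fun _ i => iter i F k) (computable_const 0 k) h).
Qed.

(** Only the numeral varies with [n]. Substitution commutes with the connectives, so passing from
    one numeral to the next applies a fixed computable step to the code. *)
Lemma computable_code (S S' : psubst) x y t :
  computable (fun n => code (psub S' (psub S (reduct x y t n)))).
Proof.
pose sub f := code (psub S' (psub S f)).
(* The tags 7 and 3 are those of [Ex] and [And] in [code]; a successor adds two layers of each. *)
pose step m := cpair 7 (cpair y (cpair 3 (cpair (sub (bR (RCons true) y x))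
  (cpair 7 (cpair x (cpair 3 (cpair (sub (bR RId x y)) m))))))).
have hstep : computable_fun (fun v : 1.-tuple nat => step (thead v)).
  by do 8!(apply: computable_cpair; first exact: computable_const);
    apply: computable_proj.
have [c hc] := computable_iter (sub (is_numeral x y 0)) hstep.
have hn : computable_fun (fun v : 1.-tuple nat => sub (is_numeral x y (thead v))).
  exists c => v; have := hc v.
  suff E n : sub (is_numeral x y n) = iter n step (sub (is_numeral x y 0)).
    by rewrite (E (thead v)).
  by elim: n => // n IH; rewrite iterS -IH.
have {c hc} [c hc] : computable_fun (fun v : 1.-tuple nat =>
    cpair 5 (cpair (sub (hyps x y t)) (cpair 7 (cpair x
      (cpair 3 (cpair (sub (is_numeral x y (thead v)))
        (sub (Ex y (bR t x y))))))))).
  do 5!(apply: computable_cpair; first exact: computable_const).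
  by apply: computable_cpair; last exact: computable_const.
by exists c => a; apply: (hc [tuple a]).
Qed.

Theorem theorem3 (L : set form) (hL : modal_logic L)
  (hrange : (QK43 `<=` L /\ L `<=` oplus QK43DX bf) \/
            (QS43 `<=` L /\ L `<=` oplus QS43 bf))
  (x y P p : nat) (hxy : x <> y) :
  Sigma01_hard (code @` [set f | L f /\ in_fragment x y P p f]).
Proof.
(* Both upper bounds hold in the universal models, so a single such model refuting a formula keeps
   it out of [L]. *)
have Lvalid : L `<=` kvalid.
  case: hrange => [[_ h]|[_ h]] f /h; first exact: kvalid_K43DX_bf.
  exact: kvalid_S43_bf.
move=> A [c hc]; have [t ht] := implementable c.
pose phi n := psub (enc_subst hxy P p) (psub (box_subst hxy t) (reduct x y t n)).
have hA a : A a <-> exists q, den t (rep [:: a]) q.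
  rewrite hc; split=> [[b hb]|[q /(ht [tuple a]) [_ [b hb _] _]]]; last by exists b.
  by exists (rep [:: b]); apply/(ht [tuple a]); exists [:: b] => //; exists b.
exists (code \o phi) => [|a]; first exact: computable_code.
rewrite hA; split=> [[q hq]|[f [Lf _] /code_inj ef]].
  exists (phi a) => //; split; last exact: enc_in_fragment.
  apply: (modal_psub hL); first by apply: capture_free_tame; apply: enc_subst_tame.
  exact: L_reduct hL _ _ _ hq.
(* A valid formula holds at every world under every assignment, so both are chosen arbitrarily. *)
apply: (@refutation x y hxy P p (WDat [::]) (fun=> inl 0)); rewrite -/(phi a) -ef.
exact: (Lvalid _ Lf).
Qed.
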